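(* Consider the matrix completion problem with objective $$f(X)=\frac1{2p}\|\mathcal{P}_\Omega(X-X_\star)\|_F^2,$$ and let $g(A,B)=f(AB^\top)$ for $(A,B)\in\mathbb{R}^{m\times r}\times\mathbb{R}^{n\times r}$. Suppose that the rank-$r$ matrix $X_\star\in\mathbb{R}^{m\times n}$ is $\mu$-incoherent, and let $\kappa(X_\star)=\sigma_1(X_\star)/\sigma_r(X_\star)$. Let $c_2>0$ be a constant, and suppose the sampling probability satisfies $$p\ge c_1\frac{\mu^2r^2\kappa^4(X_\star)(m+n)\log(m+n)}{mn}$$ for a sufficiently large constant $c_1>0$ (depending only on $c_2$). Define the local region around $X_\star$ $$\mathcal{N}(X_\star)=\Big\{X\in\mathbb{R}^{m\times n}:\ \mathrm{rank}(X)\le r,\ \|X-X_\star\|_F\le0.1\,\kappa^{-1}(X_\star)\,\sigma_r(X_\star),\ \text{and } X=AB^\top \text{ for some } (A,B)\in\mathbb{R}^{m\times r}\times\mathbb{R}^{n\times r}\text{ satisfying (i)}\Big\},$$ where (i) is the condition $$A^\top A=B^\top B,\qquad\|A\|_{2,\infty}\le c_2\sqrt{\sigma_1(X_\star)\frac{\mu r}{m}},\qquad\|B\|_{2,\infty}\le c_2\sqrt{\sigma_1(X_\star)\frac{\mu r}{n}}.$$ Then with probability larger than $1-\mathcal{O}(\min\{m,n\}^{-3})$ the following holds: for any second-order stationary point $(A,B)$ of $g$, if $X=AB^\top\in\mathcal{N}(X_\star)$, then $X=X_\star$.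
   Context: Let $m,n,r$ be positive integers with $r\le\min\{m,n\}$. $\|\cdot\|_F$ is the Frobenius norm, $\|\cdot\|_{2,\infty}$ the largest $\ell_2$ norm of any row, $\sigma_i(\cdot)$ the $i$-th largest singular value. Sampling: $\Omega\subseteq[m]\times[n]$ is random, each entry $(i,j)$ belonging to $\Omega$ independently with probability $p$; $(\mathcal{P}_\Omega(X))_{ij}=X_{ij}$ if $(i,j)\in\Omega$ and $0$ otherwise. Probability is over $\Omega$; the constant hidden in $\mathcal{O}(\cdot)$ does not depend on $m,n,r,\mu,p,X_\star$. Incoherence: let $X_\star=U_\star\Sigma_\star V_\star^\top$ be the rank-$r$ SVD of $X_\star$, $A_\star=U_\star\sqrt{\Sigma_\star}$, $B_\star=V_\star\sqrt{\Sigma_\star}$. $X_\star$ is $\mu$-incoherent if $\|A_\star\|_{2,\infty}\le\sqrt{\sigma_1(X_\star)\frac{\mu r}{m}}$ and $\|B_\star\|_{2,\infty}\le\sqrt{\sigma_1(X_\star)\frac{\mu r}{n}}$. $(A,B)$ is a second-order stationary point of $g$ if $\nabla g(A,B)=0$ and $\nabla^2g(A,B)\succeq0$. *)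

(* Defs.v *)
(* MathComp / MathComp-Analysis; the real numbers are an arbitrary R : realType. *)
From HB Require Import structures.
From mathcomp Require Import all_boot all_order all_algebra.
From mathcomp Require Import all_classical all_reals all_analysis.

Set Implicit Arguments.
Unset Strict Implicit.
Unset Printing Implicit Defensive.

Import Order.TTheory GRing.Theory Num.Theory.
Import numFieldNormedType.Exports.

Local Open Scope ring_scope.

Section Norms.
Context {R : realType}.

Definition frobenius m n (X : 'M[R]_(m, n)) : R :=
  Num.sqrt (\sum_i \sum_j X i j ^+ 2).

Definition norm2inf m n (X : 'M[R]_(m, n)) : R :=
  \big[Num.max/0]_i Num.sqrt (\sum_j X i j ^+ 2).

End Norms.

Section SingularValues.
Context {R : realType}.

(* Compact SVD X = U diag(s) V^T, with r the rank of X: s lists the nonzero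
   singular values in nonincreasing order. *)
Definition compact_svd m n r (X : 'M[R]_(m, n))
    (U : 'M[R]_(m, r)) (s : 'rV[R]_r) (V : 'M[R]_(n, r)) : Prop :=
  [/\ U^T *m U = 1%:M,
      V^T *m V = 1%:M,
      (forall k, 0 < s 0 k),
      (forall k l : 'I_r, (k <= l)%N -> s 0 l <= s 0 k)
    & X = U *m diag_mx s *m V^T].

(* sigma s i is the i-th largest singular value for 1 <= i <= r (the index
   starts at 1), when s comes from a compact SVD. *)
Definition sigma r (s : 'rV[R]_r) (i : nat) : R :=
  nth 0 [seq s 0 k | k <- enum 'I_r] i.-1.

Definition kappa r (s : 'rV[R]_r) : R := sigma s 1 / sigma s r.

Definition sqrt_factor m r (U : 'M[R]_(m, r)) (s : 'rV[R]_r) : 'M[R]_(m, r) :=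
  U *m diag_mx (map_mx Num.sqrt s).

Definition row_bound (m r : nat) (mu : R) (s : 'rV[R]_r) : R :=
  Num.sqrt (sigma s 1 * (mu * r%:R / m%:R)).

Definition incoherent m n r (mu : R)
    (U : 'M[R]_(m, r)) (s : 'rV[R]_r) (V : 'M[R]_(n, r)) : Prop :=
  norm2inf (sqrt_factor U s) <= row_bound m mu s /\
  norm2inf (sqrt_factor V s) <= row_bound n mu s.

End SingularValues.

Section SecondOrderStationarity.
Context {R : realType} {m n r : nat}.

Definition coord : finType := ('I_m * 'I_r + 'I_n * 'I_r)%type.

Definition basis_vec (e : coord) : 'M[R]_(m, r) * 'M[R]_(n, r) :=
  match e with
  | inl (i, k) => (delta_mx i k, 0)
  | inr (j, k) => (0, delta_mx j k)
  end.

Definition gradient (g : 'M[R]_(m, r) * 'M[R]_(n, r) -> R)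
    (x : 'M[R]_(m, r) * 'M[R]_(n, r)) (e : coord) : R :=
  'D_(basis_vec e) g x.

Definition hessian (g : 'M[R]_(m, r) * 'M[R]_(n, r) -> R)
    (x : 'M[R]_(m, r) * 'M[R]_(n, r)) (e e' : coord) : R :=
  'D_(basis_vec e) (fun y => 'D_(basis_vec e') g y) x.

Definition second_order_stationary (g : 'M[R]_(m, r) * 'M[R]_(n, r) -> R)
    (x : 'M[R]_(m, r) * 'M[R]_(n, r)) : Prop :=
  (forall e, gradient g x e = 0) /\
  (forall v : coord -> R, 0 <= \sum_e \sum_e' v e * hessian g x e e' * v e').

End SecondOrderStationarity.

Section MatrixCompletion.
Context {R : realType} {m n : nat}.

(* Probability of the event E when each entry belongs to Om independently with
   probability p, i.e. under the product Bernoulli law on subsets of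
   [m] x [n]. *)
Definition sampling_prob (p : R) (E : {set 'I_m * 'I_n} -> Prop) : R :=
  \sum_(Om : {set 'I_m * 'I_n} | `[< E Om >])
    \prod_(e : 'I_m * 'I_n) (if e \in Om then p else 1 - p).

Definition proj_obs (Om : {set 'I_m * 'I_n}) (X : 'M[R]_(m, n)) :
    'M[R]_(m, n) :=
  \matrix_(i, j) (if (i, j) \in Om then X i j else 0).

Definition completion_loss (p : R) (Om : {set 'I_m * 'I_n})
    (Xs X : 'M[R]_(m, n)) : R :=
  1 / (2 * p) * frobenius (proj_obs Om (X - Xs)) ^+ 2.

Definition factored_loss r (p : R) (Om : {set 'I_m * 'I_n})
    (Xs : 'M[R]_(m, n)) (x : 'M[R]_(m, r) * 'M[R]_(n, r)) : R :=
  completion_loss p Om Xs (x.1 *m x.2^T).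

Definition balanced_bounded r (c2 mu : R) (s : 'rV[R]_r)
    (A : 'M[R]_(m, r)) (B : 'M[R]_(n, r)) : Prop :=
  [/\ A^T *m A = B^T *m B,
      norm2inf A <= c2 * row_bound m mu s
    & norm2inf B <= c2 * row_bound n mu s].

(* s is the vector of nonzero singular values of Xs. *)
Definition local_region r (c2 mu : R) (Xs : 'M[R]_(m, n)) (s : 'rV[R]_r)
    (X : 'M[R]_(m, n)) : Prop :=
  [/\ (\rank X <= r)%N,
      frobenius (X - Xs) <= 10^-1 * (kappa s)^-1 * sigma s r
    & exists (A : 'M[R]_(m, r)) (B : 'M[R]_(n, r)),
        X = A *m B^T /\ balanced_bounded c2 mu s A B].

End MatrixCompletion.

(* Main.v *)
Require Import Defs.
From HB Require Import structures.
From mathcomp Require Import all_boot all_order all_algebra.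
From mathcomp Require Import all_classical all_reals all_analysis.
From mathcomp Require Import ring lra.
Import Order.TTheory GRing.Theory Num.Theory.
Import numFieldNormedType.Exports.
Local Open Scope ring_scope.

(* Write w_e = 1[e in Om] - p, A* = U sqrt(S), B* = V sqrt(S). A point X = A
   B^T of the local region can be refactored as X = AG BG^T with U^T AG =
   sqrt(S); then dA = AG - A* is orthogonal to A*, and X - X* = M + Z with M =
   dA B*^T + A* dB^T and Z = dA dB^T. Stationarity makes the observed part of
   X - X* orthogonal to M + 2Z, so |P_Om M|^2 <= 4 |P_Om Z|^2.
   Deterministically |M|^2 >= sigma_r (|dA|^2 + |dB|^2) while |Z|^2 <= |dA|^2
   sigma_r / 100, so dA = dB = 0 once the sampling errors sum w_ij M_ij^2 and
   sum w_ij Z_ij^2 are small. By incoherence these are controlled by the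
   operator norm of the centered sampling matrix and by the quadratic forms v
   |-> sum_j w_ij <v, b*_j>^2 (and their column analogues). The operator norm
   is bounded by the moments E tr (W W^T)^l, expanded over closed walks in
   which every edge occurs at least twice, with l of order log(m + n); the
   forms are bounded entrywise by Chernoff's inequality. *)

Set Implicit Arguments.
Unset Strict Implicit.
Unset Printing Implicit Defensive.

(** * Bernoulli sampling *)

(** Cauchy-Schwarz: the polynomial sum (t x_i - y_i)^2 in t is nonnegative at its minimizer t = b /
    a. When a = 0 every x_i vanishes. *)
Lemma sum_mul_sqr_le {R : realFieldType} (I : finType) (x y : I -> R) :
  (\sum_i x i * y i) ^+ 2 <= (\sum_i x i ^+ 2) * (\sum_i y i ^+ 2).
Proof.
have H (t : R) : 0 <= (\sum_i x i ^+ 2) * t ^+ 2 - 2 * (\sum_i x i * y i) * t + \sum_i y i ^+ 2.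
  have -> : (\sum_i x i ^+ 2) * t ^+ 2 - 2 * (\sum_i x i * y i) * t + \sum_i y i ^+ 2
     = \sum_i (t * x i - y i) ^+ 2.
    rewrite mulr_suml mulr_sumr mulr_suml -sumrN -!big_split /=.
    by apply: eq_bigr => i _; ring.
  by apply: sumr_ge0 => i _; exact: sqr_ge0.
set a := \sum_i x i ^+ 2 in H *; set b := \sum_i x i * y i in H *.
set c := \sum_i y i ^+ 2 in H *.
have c0 : 0 <= c by apply: sumr_ge0 => i _; exact: sqr_ge0.
have [a0|a0] := eqVneq a 0.
  have x0 i : x i = 0.
    apply/eqP; rewrite -sqrf_eq0; move/eqP: a0.
    by rewrite psumr_eq0 => [/allP/(_ i (mem_index_enum _))|j _] //; exact: sqr_ge0.
  have -> : b = 0 by rewrite /b big1 // => i _; rewrite x0 mul0r.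
  by rewrite a0 expr0n /= mul0r.
have ap : 0 < a by rewrite lt_neqAle eq_sym a0; apply: sumr_ge0 => i _; exact: sqr_ge0.
have := mulr_ge0 (ltW ap) (H (b / a)).
have -> : a * (a * (b / a) ^+ 2 - 2 * b * (b / a) + c) = a * c - b ^+ 2 by field.
by rewrite subr_ge0.
Qed.

Section Bernoulli.
Context {R : realType} {E : finType} (p : R).
Implicit Types (Om : {set E}) (f : {set E} -> R).

Definition bernoulli_weight Om : R := \prod_e (if e \in Om then p else 1 - p).

Definition expectation f : R := \sum_Om bernoulli_weight Om * f Om.

Definition centered Om e : R := (e \in Om)%:R - p.

(** Independence of the entries: expanding the right-hand product of two-term sums gives one term
    for each subset. *)
Lemma expectation_prod (F : E -> bool -> R) :
  expectation (fun Om => \prod_e F e (e \in Om)) =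
  \prod_e (p * F e true + (1 - p) * F e false).
Proof.
rewrite bigA_distr /=.
apply: eq_bigr => Om _; rewrite -big_split /=.
by apply: eq_bigr => e _; case: ifP.
Qed.

Lemma expectation1 : expectation (fun=> 1) = 1.
Proof.
transitivity (expectation (fun Om => \prod_(e : E) 1)).
  by apply: eq_bigr => Om _; rewrite big1.
rewrite (expectation_prod (fun _ _ => 1)) big1 // => e _.
by rewrite !mulr1 addrC subrK.
Qed.

Lemma eq_expectation f g : f =1 g -> expectation f = expectation g.
Proof. by move=> fg; apply: eq_bigr => Om _; rewrite fg. Qed.

Lemma expectationZ a f : expectation (fun Om => a * f Om) = a * expectation f.
Proof. by rewrite /expectation mulr_sumr; apply: eq_bigr => Om _; rewrite mulrCA. Qed.

Lemma expectationD f g :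
  expectation (fun Om => f Om + g Om) = expectation f + expectation g.
Proof. by rewrite -big_split; apply: eq_bigr => Om _; rewrite mulrDr. Qed.

Lemma expectation_sum (I : finType) (f : I -> {set E} -> R) :
  expectation (fun Om => \sum_i f i Om) = \sum_i expectation (f i).
Proof. by rewrite exchange_big; apply: eq_bigr => Om _; rewrite mulr_sumr. Qed.

Hypothesis p01 : 0 <= p <= 1.

Lemma bernoulli_weight_ge0 Om : 0 <= bernoulli_weight Om.
Proof.
case/andP: p01 => p0 p1; apply: prodr_ge0 => e _.
by case: ifP; rewrite ?subr_ge0.
Qed.

(** The expectation factors over the distinct entries of [l]. An entry of multiplicity one
    contributes its mean, zero; one of higher multiplicity contributes at most [p] in absolute
    value. *)
Lemma expectation_centered_prod (l : seq E) :
  `|expectation (fun Om => \prod_(e <- l) centered Om e)| <=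
  if has (fun e => count_mem e l == 1%N) l then 0 else p ^+ size (undup l).
Proof.
case/andP: p01 => p0 p1.
have -> : expectation (fun Om => \prod_(e <- l) centered Om e) =
    \prod_(e in l) (p * (1 - p) ^+ count_mem e l + (1 - p) * (- p) ^+ count_mem e l).
  transitivity (expectation (fun Om => \prod_e ((e \in Om)%:R - p) ^+ count_mem e l)).
    apply: eq_expectation => Om; rewrite -prodr_undup_exp_count.
    rewrite big_uniq ?undup_uniq //= big_mkcond /=; apply: eq_bigr => e _.
    by rewrite mem_undup; case: ifPn => // /count_memPn ->.
  rewrite (expectation_prod (fun e b => (b%:R - p) ^+ count_mem e l)).
  rewrite [RHS]big_mkcond /=; apply: eq_bigr => e _; rewrite sub0r.
  case: ifPn => // /count_memPn ->; rewrite !expr0; ring.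
have [/hasP[e el /eqP e1]|/hasPn l2] := boolP (has _ _).
  rewrite (bigD1 e) //= e1 !expr1 mulrN [(1 - p) * p]mulrC subrr mul0r normr0.
  by [].
rewrite normr_prod; apply: (@le_trans _ _ (\prod_(e in l) p)).
  apply: ler_prod => e el; rewrite normr_ge0 /=.
  have : (1 < count_mem e l)%N.
    have := l2 e el; have : (0 < count_mem e l)%N by rewrite -has_count has_pred1.
    by case: (count_mem e l) => [|[|]].
  case: (count_mem e l) => [|[|k]] // _.
  have q0 : 0 <= 1 - p by rewrite subr_ge0.
  have q1 : 1 - p <= 1 by rewrite gerBl.
  apply: (le_trans (ler_normD _ _)).
  rewrite !exprS !normrM !normrX normrN (ger0_norm p0) (ger0_norm q0).
  have h1 : (1 - p) ^+ k <= 1 by exact: exprn_ile1.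
  have h2 : p ^+ k <= 1 by exact: exprn_ile1.
  have h3 : 0 <= (1 - p) ^+ k by exact: exprn_ge0.
  have h4 : 0 <= p ^+ k by exact: exprn_ge0.
  (* The two terms are at most p(1 - p) and p^2 (1 - p), whose sum p - p^3 is at most p. *)
  have h5 : p * ((1 - p) * ((1 - p) * (1 - p) ^+ k)) <= p * (1 - p).
    by rewrite ler_wpM2l // ler_piMr // mulr_ile1.
  have h6 : (1 - p) * (p * (p * p ^+ k)) <= p * (1 - p) * p.
    have -> : (1 - p) * (p * (p * p ^+ k)) = p * (1 - p) * p * p ^+ k by ring.
    by rewrite ler_piMr // !mulr_ge0.
  apply: le_trans (lerD h5 h6) _.
  have : 0 <= p * p * p by rewrite !mulr_ge0.
  lra.
rewrite prodr_const; have -> : size (undup l) = #|l|; last by [].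
by rewrite -(card_uniqP (undup_uniq l)); apply: eq_card => e; rewrite mem_undup.
Qed.


Lemma double_size_undup_le (T : eqType) (l : seq T) :
  ~~ has (fun e => count_mem e l == 1%N) l -> (2 * size (undup l) <= size l)%N.
Proof.
move=> /hasPn l2; have -> : size l = (\sum_(e <- undup l) count_mem e l)%N.
  rewrite -sum1_size -big_undup_iterop_count; apply: eq_bigr => e _.
  by rewrite Monoid.iteropE iter_addn_0 mul1n.
rewrite -[size (undup l)]sum1_size big_distrr /= big_seq [leqRHS]big_seq.
apply: leq_sum => e; rewrite mem_undup => el; rewrite muln1.
have := l2 e el; have : (0 < count_mem e l)%N by rewrite -has_count has_pred1.
by case: (count_mem e l) => [|[|]].
Qed.

(* Markov's inequality for the complementary event. *)
Lemma sum_weight_ge (P : {set E} -> Prop) f :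
  (forall Om, 0 <= f Om) -> (forall Om, f Om < 1 -> P Om) ->
  1 - expectation f <= \sum_(Om | `[< P Om >]) bernoulli_weight Om.
Proof.
move=> f0 fP; rewrite lerBlDr -expectation1 /expectation.
rewrite (bigID (fun Om => `[< P Om >])) /=; apply: lerD.
  by under eq_bigr do rewrite mulr1.
rewrite [leRHS](bigID (fun Om => `[< P Om >])) /= -[leLHS]add0r; apply: lerD.
  by apply: sumr_ge0 => Om _; rewrite mulr_ge0 ?bernoulli_weight_ge0.
apply: ler_sum => Om /asboolPn nP; rewrite ler_wpM2l ?bernoulli_weight_ge0 //.
by rewrite leNgt; apply/negP => /fP.
Qed.

(** Inverting 1 - x <= exp(-x) gives exp x <= 1/(1 - x), and (1 - x)(1 + x + 2x^2) = 1 + x^2 (1 -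
    2x) >= 1 on this range. *)
Lemma expR_le_quadratic (x : R) : `|x| <= 2^-1 -> expR x <= 1 + x + 2 * x ^+ 2.
Proof.
rewrite ler_norml => /andP[x1 x2].
have h1 : 0 < 1 - x by lra.
have h2 : 1 - x <= expR (- x) by exact: expR_ge1Dx.
have : expR x <= (1 - x)^-1.
  by rewrite -[x in expR x]opprK expRN lef_pV2 // posrE expR_gt0.
move/le_trans; apply; rewrite -div1r ler_pdivrMr //.
nra.
Qed.

(** By independence the expectation is a product over entries; with x = lam c_e each factor is at
    most exp(p (exp x - 1 - x)) <= exp(2 p x^2). *)
Lemma expectation_mgf_le (c : E -> R) (lam : R) :
  (forall e, `|lam * c e| <= 2^-1) ->
  expectation (fun Om => expR (lam * \sum_e c e * centered Om e)) <=
  expR (2 * p * lam ^+ 2 * \sum_e c e ^+ 2).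
Proof.
case/andP: p01 => p0 p1 hc.
have -> : expectation (fun Om => expR (lam * \sum_e c e * centered Om e)) =
    expectation (fun Om => \prod_e expR (lam * c e * ((e \in Om)%:R - p))).
  apply: eq_expectation => Om; rewrite mulr_sumr expR_sum.
  by apply: eq_bigr => e _; rewrite mulrA.
rewrite (expectation_prod (fun e b => expR (lam * c e * (b%:R - p)))).
rewrite mulr_sumr expR_sum; apply: ler_prod => e _.
set x := lam * c e.
rewrite addr_ge0 ?mulr_ge0 ?expR_ge0 ?subr_ge0 //=.
have -> : p * expR (x * (1 - p)) + (1 - p) * expR (x * (0 - p)) =
    expR (- (p * x)) * (1 + p * (expR x - 1)).
  have -> : x * (1 - p) = - (p * x) + x by ring.
  have -> : x * (0 - p) = - (p * x) by ring.
  rewrite expRD; ring.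
apply: (@le_trans _ _ (expR (- (p * x)) * expR (p * (expR x - 1)))).
  by rewrite ler_wpM2l ?expR_ge0 // expR_ge1Dx.
rewrite -expRD ler_expR.
have := expR_le_quadratic (hc e); rewrite -/x => hx.
have -> : 2 * p * lam ^+ 2 * c e ^+ 2 = p * (2 * x ^+ 2) by rewrite /x; ring.
have : p * expR x <= p * (1 + x + 2 * x ^+ 2) by rewrite ler_wpM2l.
lra.
Qed.

(* Exponential moments witnessing the two-sided Chernoff bound
   [|sum c_e w_e| < sqrt (8 p v L)]. *)
Definition chernoff_witness (c : E -> R) (v L : R) Om : R :=
  let t := Num.sqrt (8 * p * v * L) in
  let lam := t / (4 * p * v) in
  let x := \sum_e c e * centered Om e in
  expR (- (lam * t)) * (expR (lam * x) + expR (- lam * x)).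

Lemma chernoff_witness_ge0 c v L Om : 0 <= chernoff_witness c v L Om.
Proof. by rewrite /chernoff_witness mulr_ge0 ?addr_ge0 ?expR_ge0. Qed.

(** The value of [lam] minimizes 2 p v lam^2 - lam t, with minimum -L. The condition on [M] amounts
    to lam M <= 1/2, the range in which the quadratic bound on exp is valid. *)
Lemma expectation_chernoff_witness (c : E -> R) (v L M : R) :
  0 < p -> 0 < v -> 0 <= L -> (forall e, `|c e| <= M) ->
  \sum_e c e ^+ 2 <= v -> 2 * M ^+ 2 * L <= p * v ->
  expectation (chernoff_witness c v L) <= 2 * expR (- L).
Proof.
move=> p_gt0 v0 L0 cM cv hM; rewrite expectationZ expectationD.
set t := Num.sqrt _; set lam := t / _.
have t2 : t ^+ 2 = 8 * p * v * L by rewrite sqr_sqrtr // !mulr_ge0 // ltW.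
have t0 : 0 <= t by exact: sqrtr_ge0.
have pv0 : 0 < 4 * p * v by rewrite !mulr_gt0.
have lam0 : 0 <= lam by rewrite divr_ge0 // ltW.
have lamt : lam * t = 2 * L.
  by rewrite /lam mulrAC -expr2 t2; field; rewrite !gt_eqF.
have lam2 : lam ^+ 2 * (2 * p * v) = L.
  by rewrite /lam expr_div_n t2; field; rewrite !gt_eqF.
have hl e : `|lam * c e| <= 2^-1.
  rewrite normrM (ger0_norm lam0).
  apply: (le_trans (ler_wpM2l lam0 (cM e))).
  have M0 : 0 <= M := le_trans (normr_ge0 _) (cM e).
  rewrite -(@ler_pXn2r _ 2) ?nnegrE ?mulr_ge0 ?invr_ge0 ?(ltW pv0) //.
  rewrite exprMn -(ler_pM2r (_ : 0 < 2 * p * v)) ?mulr_gt0 //.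
  rewrite mulrAC lam2.
  have -> : 2^-1 ^+ 2 * (2 * p * v) = 2^-1 * (p * v) by field.
  by lra.
have hexp lam' : lam' ^+ 2 = lam ^+ 2 -> (forall e, `|lam' * c e| <= 2^-1) ->
    expectation (fun Om => expR (lam' * \sum_e c e * centered Om e)) <= expR L.
  move=> e2 h; apply: le_trans (expectation_mgf_le h) _.
  rewrite ler_expR e2 -[leRHS]lam2.
  have -> : lam ^+ 2 * (2 * p * v) = 2 * p * lam ^+ 2 * v by ring.
  by rewrite ler_wpM2l // mulr_ge0 ?sqr_ge0 // mulr_ge0 // ltW.
have -> : 2 * expR (- L) = expR (- (lam * t)) * (expR L + expR L).
  rewrite lamt mulrDr -expRD; have -> : - (2 * L) + L = - L by ring.
  by ring.
rewrite ler_wpM2l ?expR_ge0 // lerD ?hexp // ?sqrrN // => e.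
by rewrite mulNr normrN.
Qed.

(** Both summands of the witness are positive, so each is below 1 and both exponents are negative,
    whence |x| < t. *)
Lemma chernoff_witness_lt1 c v L Om :
  0 < p -> 0 < v -> 0 < L -> chernoff_witness c v L Om < 1 ->
  (\sum_e c e * centered Om e) ^+ 2 <= 8 * p * v * L.
Proof.
rewrite /chernoff_witness => p_gt0 v0 L0.
set t := Num.sqrt _; set lam := t / _; set x := \sum_e _.
have t2 : t ^+ 2 = 8 * p * v * L by rewrite sqr_sqrtr // !mulr_ge0 // ltW.
have t0 : 0 < t by rewrite sqrtr_gt0 !mulr_gt0.
have lam0 : 0 < lam by rewrite divr_gt0 // !mulr_gt0.
rewrite mulrDr -!expRD => h.
have h1 : - (lam * t) + lam * x < 0.
  rewrite -expR_lt1; apply: le_lt_trans h; rewrite lerDl; exact: expR_ge0.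
have h2 : - (lam * t) + - lam * x < 0.
  rewrite -expR_lt1; apply: le_lt_trans h; rewrite lerDr; exact: expR_ge0.
rewrite -t2 -[x ^+ 2]real_normK ?num_real // ler_pXn2r ?nnegrE ?(ltW t0) //.
rewrite ler_norml -(ler_pM2l lam0) -(ler_pM2l lam0 x); apply/andP; split; lra.
Qed.

End Bernoulli.

(** * Frobenius inner product and trace moments *)

Section FrobeniusInner.
Context {R : realType}.

(** In trace form, moving a factor across the inner product is associativity or cyclicity of the
    trace. *)
Definition inner m n (X Y : 'M[R]_(m, n)) : R := \tr (X^T *m Y).

Definition sqn m n (X : 'M[R]_(m, n)) : R := inner X X.

Lemma innerE m n (X Y : 'M[R]_(m, n)) : inner X Y = \sum_i \sum_j X i j * Y i j.
Proof.
rewrite /inner /mxtrace exchange_big; apply: eq_bigr => i _.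
by rewrite mxE; apply: eq_bigr => j _; rewrite mxE.
Qed.

Lemma sqnE m n (X : 'M[R]_(m, n)) : sqn X = \sum_i \sum_j X i j ^+ 2.
Proof. by rewrite /sqn innerE. Qed.

Lemma innerC m n (X Y : 'M[R]_(m, n)) : inner X Y = inner Y X.
Proof. by rewrite /inner -mxtrace_tr trmx_mul trmxK. Qed.

Lemma innerDl m n (X Y Z : 'M[R]_(m, n)) : inner (X + Y) Z = inner X Z + inner Y Z.
Proof. by rewrite /inner linearD mulmxDl mxtraceD. Qed.

Lemma innerDr m n (X Y Z : 'M[R]_(m, n)) : inner X (Y + Z) = inner X Y + inner X Z.
Proof. by rewrite /inner mulmxDr mxtraceD. Qed.

Lemma inner_mulmxl m n k (A : 'M[R]_(m, k)) (X : 'M[R]_(k, n)) Y :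
  inner (A *m X) Y = inner X (A^T *m Y).
Proof. by rewrite /inner trmx_mul mulmxA. Qed.

Lemma inner_mulmxr m n k (X : 'M[R]_(m, k)) (A : 'M[R]_(k, n)) Y :
  inner (X *m A) Y = inner X (Y *m A^T).
Proof. by rewrite /inner trmx_mul -mulmxA mxtrace_mulC mulmxA. Qed.

Lemma sqn_ge0 m n (X : 'M[R]_(m, n)) : 0 <= sqn X.
Proof. by rewrite sqnE; do 2!apply: sumr_ge0 => ? _; exact: sqr_ge0. Qed.

Lemma sqn_eq0 m n (X : 'M[R]_(m, n)) : (sqn X == 0) = (X == 0).
Proof.
apply/idP/eqP => [|->]; last by rewrite /sqn /inner mulmx0 mxtrace0.
rewrite sqnE pair_big psumr_eq0 => [/allP X0|? _]; last exact: sqr_ge0.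
apply/matrixP => i j; have := X0 (i, j) (mem_index_enum _).
by rewrite /= sqrf_eq0 mxE => /eqP.
Qed.

Lemma sqn_tr m n (X : 'M[R]_(m, n)) : sqn X^T = sqn X.
Proof. by rewrite /sqn /inner trmxK mxtrace_mulC. Qed.

Lemma sqnZ m n a (X : 'M[R]_(m, n)) : sqn (a *: X) = a ^+ 2 * sqn X.
Proof.
rewrite !sqnE mulr_sumr; apply: eq_bigr => i _.
by rewrite mulr_sumr; apply: eq_bigr => j _; rewrite mxE exprMn.
Qed.

Lemma sqnD m n (X Y : 'M[R]_(m, n)) : sqn (X + Y) = sqn X + 2 * inner X Y + sqn Y.
Proof. by rewrite /sqn innerDl !innerDr (innerC Y X); ring. Qed.

Lemma sqnN m n (X : 'M[R]_(m, n)) : sqn (- X) = sqn X.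
Proof. by rewrite -scaleN1r sqnZ sqrrN expr1n mul1r. Qed.

Lemma innerNr m n (X Y : 'M[R]_(m, n)) : inner X (- Y) = - inner X Y.
Proof. by rewrite /inner mulmxN raddfN. Qed.

Lemma sqnD_le m n (X Y : 'M[R]_(m, n)) : sqn (X + Y) <= 2 * sqn X + 2 * sqn Y.
Proof.
have := sqn_ge0 (X - Y); rewrite sqnD sqnN sqnD innerNr.
lra.
Qed.

Lemma inner_sqr_le m n (X Y : 'M[R]_(m, n)) : inner X Y ^+ 2 <= sqn X * sqn Y.
Proof. by rewrite innerE !sqnE !pair_big /=; exact: sum_mul_sqr_le. Qed.

Lemma sqn_mulmx_le m n k (A : 'M[R]_(m, k)) (B : 'M[R]_(k, n)) :
  sqn (A *m B) <= sqn A * sqn B.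
Proof.
rewrite !sqnE [X in _ * X]exchange_big mulr_suml; apply: ler_sum => i _.
rewrite mulr_sumr; apply: ler_sum => j _; rewrite mxE; exact: sum_mul_sqr_le.
Qed.

Lemma sqn_row_sum m n (X : 'M[R]_(m, n)) : sqn X = \sum_i sqn (row i X).
Proof.
rewrite sqnE; apply: eq_bigr => i _; rewrite sqnE big_ord1.
by apply: eq_bigr => j _; rewrite mxE.
Qed.

Lemma trmx_exp n (G : 'M[R]_n) k : (G ^+ k)^T = G^T ^+ k.
Proof.
elim: k => [|k IH]; first by rewrite !expr0 trmx1.
by rewrite exprS trmx_mul IH exprSr.
Qed.

(* Squaring repeatedly, [|W^T x|^2 = <x, G x>] with [G = W W^T] and
   [<x, G^k x>^2 <= |x|^2 |G^k x|^2 = |x|^2 <x, G^(2k) x>]. *)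
Lemma sqn_mul_exp_le_trace m n (W : 'M[R]_(m, n)) (x : 'cV[R]_m) a :
  sqn (W^T *m x) ^+ (2 ^ a) <=
  sqn x ^+ (2 ^ a) * \tr ((W *m W^T) ^+ (2 ^ a)).
Proof.
set G := W *m W^T; set s := sqn x.
have Gsym k : (G ^+ k)^T = G ^+ k by rewrite trmx_exp trmx_mul trmxK.
have Gdouble k : inner x (G ^+ (k + k) *m x) = sqn (G ^+ k *m x).
  by rewrite /sqn inner_mulmxl Gsym mulmxA exprD -mulmxE.
have s0 : 0 <= s := sqn_ge0 x.
have [sz|snz] := eqVneq s 0.
  move/eqP: sz; rewrite sqn_eq0 => /eqP x0; rewrite /s x0 mulmx0.
  by rewrite /sqn /inner !mulmx0 !mxtrace0 !expr0n expn_eq0 /= mul0r.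
have sp : 0 < s by rewrite lt_neqAle eq_sym snz.
pose Q k := inner x (G ^+ k *m x).
have Q1 : Q 1%N = sqn (W^T *m x).
  by rewrite /Q expr1 /sqn inner_mulmxl trmxK mulmxA.
have Q0 b : 0 <= Q (2 ^ b)%N.
  case: b => [|b]; first by rewrite expn0 Q1 sqn_ge0.
  by rewrite expnS mul2n -addnn /Q Gdouble sqn_ge0.
(* The extra [s] on the left stands for an exponent 2^b - 1 on the right. Each induction step
   squares the inequality and applies [h]. *)
have chain b : Q 1%N ^+ (2 ^ b) * s <= s ^+ (2 ^ b) * Q (2 ^ b)%N.
  elim: b => [|b IH]; first by rewrite expn0 !expr1 mulrC.
  have e : (2 ^ b.+1 = 2 ^ b + 2 ^ b)%N by rewrite expnS mul2n addnn.
  have h : Q (2 ^ b)%N ^+ 2 <= s * Q (2 ^ b.+1)%N.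
    by rewrite e /Q Gdouble inner_sqr_le.
  rewrite -(ler_pM2r sp) e !exprD -e.
  have l0 : 0 <= Q 1%N ^+ (2 ^ b) * s.
    by rewrite mulr_ge0 ?exprn_ge0 // -(expn0 2) Q0.
  have IH2 := ler_pM l0 l0 IH IH.
  have h2 := ler_wpM2l (sqr_ge0 (s ^+ (2 ^ b))) h.
  rewrite -!expr2 in IH2 *.
  apply: le_trans (le_trans IH2 _).
    by rewrite le_eqVlt; apply/orP; left; apply/eqP; ring.
  rewrite exprMn; apply: le_trans h2 _.
  by rewrite le_eqVlt; apply/orP; left; apply/eqP; ring.
(* For a = b + 1, Q(2^a) = |G^(2^b) x|^2 is at most |x|^2 times the squared Frobenius norm of
   G^(2^b), which is tr G^(2^a). *)
have trbound : Q (2 ^ a)%N <= s * \tr (G ^+ (2 ^ a)).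
  case: a => [|b].
    rewrite expn0 Q1 expr1 mulrC; apply: le_trans (sqn_mulmx_le _ _) _.
    by rewrite /sqn /inner trmxK.
  rewrite expnS mul2n -addnn /Q Gdouble mulrC.
  apply: le_trans (sqn_mulmx_le _ _) _.
  by rewrite /sqn /inner Gsym exprD.
rewrite -(ler_pM2r sp) -Q1; apply: le_trans (chain a) _.
by rewrite -mulrA (mulrC _ s) ler_wpM2l // exprn_ge0.
Qed.

(** Taking the 2^a-th root turns a trace moment into an operator-norm bound. *)
Lemma sqn_mul_le_of_trace m n (W : 'M[R]_(m, n)) (T : R) a :
  0 <= T -> \tr ((W *m W^T) ^+ (2 ^ a)) <= T ^+ (2 ^ a) ->
  forall x : 'cV[R]_m, sqn (W^T *m x) <= T * sqn x.
Proof.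
move=> T0 hT x; rewrite -(@ler_pXn2r _ (2 ^ a)) ?expn_gt0 ?nnegrE ?mulr_ge0 ?sqn_ge0 //.
apply: le_trans (sqn_mul_exp_le_trace W x a) _.
by rewrite exprMn mulrC ler_wpM2r // exprn_ge0 // sqn_ge0.
Qed.

End FrobeniusInner.

(** * Trace moments of the centered sampling matrix by walk counting *)

Section WalkCounting.
Context {R : realType} {E : finType}.

(** A new edge either costs a factor [q] or already lies in [h], and by injectivity at most [size h]
    indices give the latter. *)
Lemma sum_exp_size_undup_le (I : finType) (f : I -> E) (h : seq E) (q : R) :
  injective f -> 0 <= q ->
  \sum_i q ^+ size (undup (f i :: h)) <=
  (#|I|%:R * q + (size h)%:R) * q ^+ size (undup h).
Proof.
move=> finj q0; rewrite mulrDl (bigID (fun i => f i \in h)) /= addrC.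
apply: lerD.
  apply: (@le_trans _ _ (\sum_(i : I) q * q ^+ size (undup h))).
    rewrite [leRHS](bigID (fun i => f i \in h)) /= -[leLHS]add0r; apply: lerD.
      by apply: sumr_ge0 => *; rewrite mulr_ge0 ?exprn_ge0.
    by apply: ler_sum => i /negbTE ->; rewrite exprS.
  by rewrite sumr_const -mulrA mulr_natl.
under eq_bigr => i -> do over.
rewrite sumr_const mulr_natl; apply: ler_wpMn2l; first exact: exprn_ge0.
rewrite -(fintype.card_image finj); apply: leq_trans (card_size h).
apply: subset_leq_card; apply/fintype.subsetP => e /fintype.imageP[i ih ->].
exact: ih.
Qed.

End WalkCounting.

Section TraceMoment.
Context {R : realType} {m n : nat} (p : R).
Implicit Types Om : {set 'I_m * 'I_n}.

Definition centered_mx Om : 'M[R]_(m, n) := \matrix_(i, j) centered p Om (i, j).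

Let gram Om := centered_mx Om *m (centered_mx Om)^T.

(** The contribution of all walks with a given beginning: [h] lists the edges already traversed, and
    the power of [gram Om] sums over the remaining k double steps from i to i'. *)
Let walk_moment k i i' (h : seq ('I_m * 'I_n)) : R :=
  expectation p (fun Om => (\prod_(e <- h) centered p Om e) * (gram Om ^+ k) i i').

Let walk_momentS k i i' h :
  walk_moment k.+1 i i' h =
  \sum_j \sum_i1 walk_moment k i1 i' ((i1, j) :: (i, j) :: h).
Proof.
rewrite /walk_moment.
under eq_bigr do rewrite -expectation_sum.
rewrite -expectation_sum; apply: eq_expectation => Om.
rewrite exprS mxE exchange_big mulr_sumr; apply: eq_bigr => i1 _.
rewrite mxE mulr_suml mulr_sumr; apply: eq_bigr => j _.
by rewrite !big_cons !mxE; ring.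
Qed.

(** A closed walk of length 2l with nonzero expectation has u <= l distinct edges, so it contributes
    at most p^u <= th^(-l) q^u, where q = p th and th <= 1. Summing q^u one edge at a time costs at
    most 4l per edge, for a total of m th^(-l) (4l)^(2l) = m (8 l p N)^l. *)
Lemma expectation_trace_le l :
  0 < p <= 1 -> (0 < l)%N -> (2 * l)%:R <= p * (m + n)%:R ->
  expectation p (fun Om => \tr ((centered_mx Om *m (centered_mx Om)^T) ^+ l)) <=
  m%:R * (8 * l%:R * (p * (m + n)%:R)) ^+ l.
Proof.
move=> /andP[p0 p1] l0 hl.
have [N NE] : {N : R | N = (m + n)%:R} by exists (m + n)%:R.
rewrite -NE in hl *.
have l0' : 0 < l%:R :> R by rewrite ltr0n.
have hl' : 2 * l%:R <= p * N by rewrite -natrM.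
have N0 : 0 < N.
  by rewrite -(pmulr_rgt0 _ p0); apply: lt_le_trans hl'; rewrite mulr_gt0.
(* With N q = 2l, all new edges together weigh at most 2l, the same as the bound on the number of
   old ones. *)
have [q qN] : {q : R | q = 2 * l%:R / N} by eexists.
have [th thN] : {th : R | th = 2 * l%:R / (p * N)} by eexists.
have q0 : 0 <= q by rewrite qN divr_ge0 ?mulr_ge0 // ltW.
have th0 : 0 < th by rewrite thN divr_gt0 ?mulr_gt0.
have th1 : th <= 1 by rewrite thN ler_pdivrMr ?mulr_gt0 // mul1r.
have qE : q = p * th by rewrite qN thN; field; rewrite !gt_eqF.
(* Induction on the number k of remaining double steps, uniformly in the history [h]. Multiplicities
   are examined only at k = 0, when the whole walk is known. *)
have key k : (k <= l)%N -> forall i i' h, size h = (2 * (l - k))%N ->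
    `|walk_moment k i i' h| <=
    th ^- l * (4 * l%:R) ^+ (2 * k) * q ^+ size (undup h).
  elim: k => [|k IH] kl i i' h sh.
    rewrite muln0 expr0 mulr1.
    have -> : walk_moment 0 i i' h = (i == i')%:R *
        expectation p (fun Om => \prod_(e <- h) centered p Om e).
      rewrite -expectationZ; apply: eq_expectation => Om.
      by rewrite expr0 mxE mulrC.
    have r0 : 0 <= th ^- l * q ^+ size (undup h).
      by rewrite mulr_ge0 ?exprn_ge0 // invr_ge0 exprn_ge0 // ltW.
    rewrite normrM; case: (i == i'); last by rewrite normr0 mul0r.
    rewrite normr1 mul1r.
    apply: le_trans (expectation_centered_prod _ h) _; first by rewrite (ltW p0).
    case: ifPn => // /double_size_undup_le; rewrite sh subn0 leq_pmul2l // => hu.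
    rewrite qE exprMn mulrCA -[leLHS]mulr1; apply: ler_wpM2l.
      by rewrite exprn_ge0 // ltW.
    rewrite mulrC ler_pdivlMr ?exprn_gt0 // mul1r.
    by apply: ler_wiXn2l => //; exact: ltW.
  rewrite walk_momentS.
  apply: le_trans (ler_norm_sum _ _ _) _.
  set Cst := th ^- l * (4 * l%:R) ^+ (2 * k).
  have Cst0 : 0 <= Cst.
    by rewrite mulr_ge0 ?exprn_ge0 ?invr_ge0 ?exprn_ge0 ?mulr_ge0 // ltW.
  have step (s u : nat) (su : (s <= 2 * l)%N) : (u <= m + n)%N ->
      u%:R * q + s%:R <= 4 * l%:R.
    move=> uN; have : u%:R * q <= N * q by rewrite ler_wpM2r // NE ler_nat.
    have -> : N * q = 2 * l%:R by rewrite qN; field; rewrite gt_eqF.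
    have : s%:R <= (2 * l)%:R :> R by rewrite ler_nat.
    rewrite natrM; lra.
  have szle : (size h < 2 * l)%N.
    by rewrite sh ltn_pmul2l // subnS prednK ?leq_subr // subn_gt0.
  apply: (@le_trans _ _ (\sum_j Cst * (4 * l%:R * q ^+ size (undup ((i, j) :: h))))).
    apply: ler_sum => j _; apply: le_trans (ler_norm_sum _ _ _) _.
    apply: (@le_trans _ _ (\sum_i1 Cst * q ^+ size (undup ((i1, j) :: (i, j) :: h)))).
      apply: ler_sum => i1 _; apply: IH; first exact: ltnW.
      by rewrite /= sh -[(l - k)%N](@prednK) ?subn_gt0 // -subnS mulnS.
    rewrite -mulr_sumr ler_wpM2l //.
    apply: (le_trans (@sum_exp_size_undup_le _ _ _ (fun i1 => (i1, j)) _ q _ q0)).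
      by move=> ? ? [].
    rewrite ler_wpM2r ?exprn_ge0 // card_ord step // leq_addr.
    by [].
  rewrite -!mulr_sumr.
  have -> : (2 * k.+1 = (2 * k).+2)%N by rewrite mulnS.
  rewrite !exprS.
  have -> : th ^- l * (4 * l%:R * (4 * l%:R * (4 * l%:R) ^+ (2 * k))) *
      q ^+ size (undup h) = Cst * (4 * l%:R * (4 * l%:R * q ^+ size (undup h))).
    by rewrite /Cst; ring.
  rewrite ler_wpM2l // ler_wpM2l ?mulr_ge0 ?(ltW l0') //.
  apply: (le_trans (@sum_exp_size_undup_le _ _ _ (fun j => (i, j)) _ q _ q0)).
    by move=> ? ? [].
  by rewrite ler_wpM2r ?exprn_ge0 // card_ord step ?leq_addl // ltnW.
have -> : expectation p (fun Om => \tr ((centered_mx Om *m (centered_mx Om)^T) ^+ l)) =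
    \sum_i walk_moment l i i [::].
  rewrite -expectation_sum; apply: eq_expectation => Om; apply: eq_bigr => i _.
  by rewrite big_nil mul1r.
apply: (@le_trans _ _ (\sum_(i < m) th ^- l * (4 * l%:R) ^+ (2 * l))).
  apply: ler_sum => i _; apply: le_trans (ler_norm _) _.
  have := key l (leqnn l) i i [::]; rewrite subnn muln0 => /(_ erefl).
  by rewrite /= expr0 mulr1.
rewrite sumr_const card_ord -[_ *+ m]mulr_natl exprM -exprVn -exprMn.
rewrite le_eqVlt; apply/orP; left; apply/eqP; congr (_ * _ ^+ _).
by rewrite thN; field; rewrite !gt_eqF.
Qed.

End TraceMoment.

(** * Stationarity *)

(** Away from h = 0 the difference quotient equals a + h b, which tends to a. *)
Lemma derive_quadratic {R : realType} (V : normedModType R) (g : V -> R) (x v : V) (a b : R) :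
  (forall h : R, g (h *: v + x) = g x + h * a + h ^+ 2 * b) -> 'D_v g x = a.
Proof.
move=> gE; apply: cvg_lim; first exact: Rhausdorff.
apply: (@cvg_trans _ ((fun h : R => a + h * b) @ (0 : R)^')%classic).
  apply: near_eq_cvg; near=> h.
  have h0 : h != 0 by near: h; exact: nbhs_dnbhs_neq.
  rewrite /= gE /GRing.scale /=; field.
  exact: h0.
apply: cvg_within_filter.
have : ((fun h : R => a + h * b) @ (0 : R) --> a + 0 * b)%classic.
  by apply: cvgD; [exact: cvg_cst | apply: cvgMl; exact: cvg_id].
by rewrite mul0r addr0.
Unshelve. all: by end_near.
Qed.

Section Stationarity.
Context {R : realType} {m n r : nat}.

Lemma frobenius_sqr k l (X : 'M[R]_(k, l)) : frobenius X ^+ 2 = sqn X.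
Proof. rewrite /frobenius sqr_sqrtr ?sqnE //; do 2!apply: sumr_ge0 => ? _; exact: sqr_ge0. Qed.

Lemma inner_delta k l (X : 'M[R]_(k, l)) i j : inner X (delta_mx i j) = X i j.
Proof.
rewrite innerE (bigD1 i) //= (bigD1 j) //= mxE !eqxx mulr1 !big1 ?addr0 //.
  by move=> i' ii'; rewrite big1 // => j' _; rewrite mxE (negbTE ii') mulr0.
by move=> j' jj'; rewrite mxE (negbTE jj') andbF mulr0.
Qed.

Lemma inner_proj_obs Om (X Y : 'M[R]_(m, n)) :
  inner (proj_obs Om X) (proj_obs Om Y) = inner (proj_obs Om X) Y.
Proof.
rewrite !innerE; apply: eq_bigr => i _; apply: eq_bigr => j _; rewrite !mxE.
by case: ifP; rewrite ?mul0r.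
Qed.

Lemma completion_lossD p Om (Xs X K : 'M[R]_(m, n)) h : p != 0 ->
  completion_loss p Om Xs (X + h *: K) = completion_loss p Om Xs X +
    h * (p^-1 * inner (proj_obs Om (X - Xs)) K) +
    h ^+ 2 * (1 / (2 * p) * sqn (proj_obs Om K)).
Proof.
move=> p0; rewrite /completion_loss !frobenius_sqr.
have -> : proj_obs Om (X + h *: K - Xs) = proj_obs Om (X - Xs) + h *: proj_obs Om K.
  apply/matrixP => i j; rewrite !mxE; case: ifP => _; last by rewrite mulr0 addr0.
  by ring.
rewrite sqnD sqnZ.
have -> : inner (proj_obs Om (X - Xs)) (h *: proj_obs Om K) =
    h * inner (proj_obs Om (X - Xs)) K.
  by rewrite -[in RHS]inner_proj_obs /inner -scalemxAr mxtraceZ.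
by field.
Qed.

(** Varying one entry of a factor moves [A *m B^T] along a line, so the loss is exactly quadratic
    there; its partial derivatives are [p^-1] times the entries of [S *m B] and [S^T *m A]. *)
Lemma stationary_residual p Om (Xs : 'M[R]_(m, n)) (A : 'M[R]_(m, r)) (B : 'M[R]_(n, r)) :
  p != 0 -> second_order_stationary (factored_loss p Om Xs) (A, B) ->
  let S := proj_obs Om (A *m B^T - Xs) in S *m B = 0 /\ S^T *m A = 0.
Proof.
move=> p0 [grad0 _] S; split; apply/matrixP => i k; rewrite [RHS]mxE.
  have := grad0 (inl (i, k)).
  rewrite /gradient /= (@derive_quadratic _ _ _ _ _ (p^-1 * inner S (delta_mx i k *m B^T))
    (1 / (2 * p) * sqn (proj_obs Om (delta_mx i k *m B^T)))).
    move/eqP; rewrite mulf_eq0 invr_eq0 (negbTE p0) /= => /eqP.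
    by rewrite innerC inner_mulmxr trmxK innerC inner_delta.
  move=> h; rewrite -completion_lossD // /factored_loss /=.
  by rewrite scaler0 add0r mulmxDl addrC scalemxAl.
have := grad0 (inr (i, k)).
rewrite /gradient /= (@derive_quadratic _ _ _ _ _ (p^-1 * inner S (A *m (delta_mx i k)^T))
    (1 / (2 * p) * sqn (proj_obs Om (A *m (delta_mx i k)^T)))).
  move/eqP; rewrite mulf_eq0 invr_eq0 (negbTE p0) /= => /eqP.
  rewrite innerC inner_mulmxl trmx_delta innerC inner_delta => <-.
  by rewrite -[in RHS](trmxK S) -trmx_mul [RHS]mxE.
move=> h; rewrite -completion_lossD // /factored_loss /=.
by rewrite scaler0 add0r linearD /= mulmxDr addrC linearZ /= -scalemxAr.
Qed.
End Stationarity.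

(** * Alignment of factors *)

Section Alignment.
Context {R : realType}.

(** Expand |X/2 + 2Y|^2 >= 0, whose cross term is the same 2<X, Y> as that of |X + Y|^2. *)
Lemma sqnD_ge m n (X Y : 'M[R]_(m, n)) : 3 / 4 * sqn X - 3 * sqn Y <= sqn (X + Y).
Proof.
have := sqn_ge0 (2^-1 *: X + 2 *: Y); rewrite !sqnD !sqnZ.
have -> : inner (2^-1 *: X) (2 *: Y) = inner X Y.
  by rewrite /inner [(_ *: X)^T]linearZ /= -scalemxAl -scalemxAr scalerA mulVf ?scale1r.
lra.
Qed.

Lemma sqn_isometry m k n (U : 'M[R]_(m, k)) (Y : 'M[R]_(k, n)) :
  U^T *m U = 1%:M -> sqn (U *m Y) = sqn Y.
Proof. by move=> UU; rewrite /sqn inner_mulmxl mulmxA UU mul1mx. Qed.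

(** Pythagoras: |Y - U U^T Y|^2 = |Y|^2 - |U^T Y|^2. *)
Lemma sqn_isometry_tr_le m k n (U : 'M[R]_(m, k)) (Y : 'M[R]_(m, n)) :
  U^T *m U = 1%:M -> sqn (U^T *m Y) <= sqn Y.
Proof.
move=> UU; have := sqn_ge0 (Y + - (U *m (U^T *m Y))).
rewrite sqnD sqnN (sqn_isometry _ UU).
have -> : inner Y (- (U *m (U^T *m Y))) = - sqn (U^T *m Y).
  by rewrite innerNr innerC inner_mulmxl.
lra.
Qed.

Lemma sqn_mul_diag m n (Y : 'M[R]_(m, n)) (d : 'rV[R]_n) :
  sqn (Y *m diag_mx d) = \sum_i \sum_j d 0 j ^+ 2 * Y i j ^+ 2.
Proof.
rewrite sqnE; apply: eq_bigr => i _; apply: eq_bigr => j _.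
by rewrite mul_mx_diag mxE exprMn mulrC.
Qed.

Lemma sqn_mul_diag_le m n (Y : 'M[R]_(m, n)) (d : 'rV[R]_n) b :
  (forall j, d 0 j ^+ 2 <= b) -> sqn (Y *m diag_mx d) <= b * sqn Y.
Proof.
move=> db; rewrite sqn_mul_diag sqnE mulr_sumr; apply: ler_sum => i _.
by rewrite mulr_sumr; apply: ler_sum => j _; rewrite ler_wpM2r ?sqr_ge0.
Qed.

Lemma sqn_mul_diag_ge m n (Y : 'M[R]_(m, n)) (d : 'rV[R]_n) b :
  (forall j, b <= d 0 j ^+ 2) -> b * sqn Y <= sqn (Y *m diag_mx d).
Proof.
move=> db; rewrite sqn_mul_diag sqnE mulr_sumr; apply: ler_sum => i _.
by rewrite mulr_sumr; apply: ler_sum => j _; rewrite ler_wpM2r ?sqr_ge0.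
Qed.

(* With [P = A^T A = B^T B] one has [<v, P^3 v> = |X^T A v|^2 <= s^2 <v, P v>];
   Cauchy-Schwarz then gives [<v, P^2 v> <= s <v, P v>] and [<v, P v> <= s |v|^2]. *)
Lemma sqn_balanced_factor_le m n r (A : 'M[R]_(m, r)) (B : 'M[R]_(n, r)) (s : R) :
  A^T *m A = B^T *m B -> 0 <= s ->
  (forall u : 'cV_m, sqn ((A *m B^T)^T *m u) <= s ^+ 2 * sqn u) ->
  forall v : 'cV_r, sqn (A *m v) <= s * sqn v.
Proof.
move=> AB s0 hX v; set P := A^T *m A.
have PT : P^T = P by rewrite /P trmx_mul trmxK.
have a3 : sqn (A *m (P *m v)) <= s ^+ 2 * sqn (A *m v).
  have <- : sqn ((A *m B^T)^T *m (A *m v)) = sqn (A *m (P *m v)).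
    have -> : (A *m B^T)^T *m (A *m v) = B *m (P *m v).
      by rewrite trmx_mul trmxK /P !mulmxA.
    by move: (P *m v) => w; rewrite /sqn !inner_mulmxl !mulmxA AB.
  exact: hX.
have a2 : sqn (P *m v) = inner (A *m v) (A *m (P *m v)).
  by rewrite /sqn inner_mulmxl inner_mulmxl PT /P !mulmxA.
have a1 : sqn (A *m v) = inner v (P *m v).
  by rewrite /sqn inner_mulmxl /P mulmxA.
have a1_0 := sqn_ge0 (A *m v).
have a2le : sqn (P *m v) <= s * sqn (A *m v).
  rewrite -(@ler_pXn2r _ 2) ?nnegrE ?mulr_ge0 ?sqn_ge0 // {1}a2.
  apply: le_trans (inner_sqr_le _ _) _.
  have -> : (s * sqn (A *m v)) ^+ 2 = sqn (A *m v) * (s ^+ 2 * sqn (A *m v)) by ring.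
  by rewrite ler_wpM2l.
have := inner_sqr_le v (P *m v); rewrite -a1 => h.
have v0 := sqn_ge0 v.
have h2 : sqn (A *m v) * sqn (A *m v) <= s * sqn v * sqn (A *m v).
  rewrite -expr2; apply: le_trans h _.
  by rewrite (mulrC s) -mulrA ler_wpM2l.
have [z|nz] := eqVneq (sqn (A *m v)) 0; first by rewrite z mulr_ge0.
by rewrite -(ler_pM2r (_ : 0 < sqn (A *m v))) // lt_neqAle eq_sym nz.
Qed.

Section Svd.
Context {m n r : nat} (U : 'M[R]_(m, r)) (s : 'rV[R]_r) (V : 'M[R]_(n, r)).
Context (s1 sr : R).
Hypothesis UU : U^T *m U = 1%:M.
Hypothesis VV : V^T *m V = 1%:M.
Hypothesis sr_gt0 : 0 < sr.
Hypothesis s_bounds : forall k, sr <= s 0 k <= s1.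

Let s_gt0 k : 0 < s 0 k.
Proof. by apply: lt_le_trans sr_gt0 _; case/andP: (s_bounds k). Qed.

Lemma svd_sqrt_factor :
  U *m diag_mx s *m V^T = sqrt_factor U s *m (sqrt_factor V s)^T.
Proof.
rewrite /sqrt_factor trmx_mul tr_diag_mx !mulmxA -[in RHS](mulmxA U) mulmx_diag.
congr (_ *m diag_mx _ *m _); apply/rowP => k; rewrite !mxE.
by rewrite -expr2 sqr_sqrtr // ltW.
Qed.

Lemma sqn_mul_sqrt_factor_ge k (Y : 'M[R]_(k, r)) :
  sr * sqn Y <= sqn (Y *m (sqrt_factor V s)^T).
Proof.
rewrite /sqrt_factor trmx_mul tr_diag_mx mulmxA -[leRHS]sqn_tr trmx_mul trmxK.
rewrite (sqn_isometry _ VV) sqn_tr; apply: sqn_mul_diag_ge => j.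
by rewrite mxE sqr_sqrtr ?(ltW (s_gt0 j)) //; case/andP: (s_bounds j).
Qed.

Lemma sqn_svd_tr_mul_le k (Y : 'M[R]_(m, k)) : 0 <= s1 ->
  sqn ((U *m diag_mx s *m V^T)^T *m Y) <= s1 ^+ 2 * sqn Y.
Proof.
move=> s10; rewrite !trmx_mul trmxK tr_diag_mx -mulmxA (sqn_isometry _ VV) -mulmxA.
rewrite -sqn_tr trmx_mul tr_diag_mx.
apply: (@le_trans _ _ (s1 ^+ 2 * sqn (U^T *m Y)^T)).
  apply: sqn_mul_diag_le => j; rewrite ler_pXn2r ?nnegrE ?(ltW (s_gt0 j)) //.
  by case/andP: (s_bounds j).
by rewrite sqn_tr ler_wpM2l ?sqr_ge0 // sqn_isometry_tr_le.
Qed.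

(* The aligned factors are [BG = X^T U S^(-1/2)] and the matching [AG]; the
   alignment matrix is chosen so that [U^T AG = S^(1/2)], which makes the two
   parts of the first-order term of [X - Xs] orthogonal. *)
Lemma aligned_factors (A : 'M[R]_(m, r)) (B : 'M[R]_(n, r)) :
  let Xs := U *m diag_mx s *m V^T in
  let As := sqrt_factor U s in let Bs := sqrt_factor V s in
  sr <= s1 -> A^T *m A = B^T *m B -> 100 * sqn (A *m B^T - Xs) <= sr ^+ 2 ->
  exists (AG : 'M[R]_(m, r)) (BG : 'M[R]_(n, r)) (Q : 'M[R]_(m, r)),
  [/\ A *m B^T = AG *m BG^T /\ BG = (A *m B^T)^T *m Q,
      forall k (Y : 'M[R]_(k, r)), Y *m BG^T = 0 -> Y = 0,
      As^T *m (AG - As) = 0,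
      100 * sqn (BG - Bs) <= sr
    & (forall i, sqn (row i AG) <= 4 * (s1 / sr) * sqn (row i A)) /\
      (forall j, sqn (row j BG) <= 4 * (s1 / sr) * sqn (row j B))].
Proof.
move=> Xs As Bs s1r AB hD.
have s10 : 0 < s1 by exact: lt_le_trans s1r.
set X := A *m B^T in hD *.
pose sq := diag_mx (map_mx Num.sqrt s).
pose isq := diag_mx (map_mx (fun x => (Num.sqrt x)^-1) s).
have sqK : sq *m isq = 1%:M.
  rewrite /sq /isq mulmx_diag -diag_const_mx; congr diag_mx; apply/rowP => k.
  by rewrite !mxE divff // gt_eqF // sqrtr_gt0.
have isqK : isq *m sq = 1%:M by rewrite /isq /sq diag_mxC.
have isq_le k (Y : 'M[R]_(k, r)) : sr * sqn (Y *m isq) <= sqn Y.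
  rewrite mulrC -ler_pdivlMr // mulrC; apply: sqn_mul_diag_le => j.
  rewrite mxE exprVn sqr_sqrtr ?(ltW (s_gt0 j)) //.
  by rewrite lef_pV2 ?posrE //; case/andP: (s_bounds j).
(* Since BG = B H, the matching left factor is A H^(-T), provided that H is invertible. *)
pose Q := U *m isq; pose BG := X^T *m Q; pose H := A^T *m Q.
have BGH : BG = B *m H by rewrite /BG /X trmx_mul trmxK /H mulmxA.
(* The same recipe applied to Xs returns Bs, so BG - Bs is linear in X - Xs. *)
have XsQ : Xs^T *m Q = Bs.
  rewrite /Xs /Q /Bs /sqrt_factor !trmx_mul trmxK tr_diag_mx.
  rewrite -!mulmxA [U^T *m _]mulmxA UU mul1mx mulmx_diag.
  congr (_ *m diag_mx _); apply/rowP => k; rewrite !mxE.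
  by rewrite -{1}[s 0 k]sqr_sqrtr ?(ltW (s_gt0 k)) // expr2 mulfK // gt_eqF // sqrtr_gt0.
have dBE : BG - Bs = (X - Xs)^T *m U *m isq.
  by rewrite -XsQ /BG -mulmxBl -linearB /= mulmxA.
have dB : 100 * sqn (BG - Bs) <= sr.
  rewrite -(ler_pM2r sr_gt0) -expr2 dBE; apply: le_trans hD.
  rewrite -mulrA ler_wpM2l // mulrC; apply: le_trans (isq_le _ _) _.
  by rewrite -sqn_tr trmx_mul trmxK; exact: sqn_isometry_tr_le.
(* BG is within sqrt(sr)/10 of Bs, so the lower bound survives with constant 3/4 - 3/100 >= 1/2. *)
have BGlow k (Y : 'M[R]_(k, r)) : sr * sqn Y <= 2 * sqn (Y *m BG^T).
  have -> : Y *m BG^T = Y *m Bs^T + Y *m (BG - Bs)^T.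
    by rewrite -mulmxDr -linearD /= addrC subrK.
  have h1 := sqnD_ge (Y *m Bs^T) (Y *m (BG - Bs)^T).
  have h2 := sqn_mul_sqrt_factor_ge Y; rewrite -/Bs in h2.
  have h3 := sqn_mulmx_le Y (BG - Bs)^T; rewrite [sqn (BG - Bs)^T]sqn_tr in h3.
  have h4 := ler_wpM2l (sqn_ge0 Y) dB.
  have h5 := mulr_ge0 (ltW sr_gt0) (sqn_ge0 Y).
  by nra.
have inj k (Y : 'M[R]_(k, r)) : Y *m BG^T = 0 -> Y = 0.
  move=> Y0; apply/eqP.
  rewrite -sqn_eq0 eq_le sqn_ge0 andbT -(ler_pM2l sr_gt0) mulr0.
  have := BGlow _ Y; have -> : sqn (Y *m BG^T) = 0 by apply/eqP; rewrite sqn_eq0 Y0.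
  by rewrite mulr0.
(* If y H^T = 0 then y BG^T = y H^T B^T = 0, and BG^T is injective. *)
have Hu : H^T \in unitmx.
  rewrite -row_free_unit; apply: inj_row_free => y yH.
  by apply: inj; rewrite BGH trmx_mul mulmxA yH mul0mx.
pose AG := A *m invmx H^T.
have XG : X = AG *m BG^T.
  by rewrite BGH trmx_mul /AG mulmxA mulmxKV.
have UAG : U^T *m AG = sq.
  have e : sq *m H^T = U^T *m A.
    by rewrite /H trmx_mul trmxK /Q trmx_mul tr_diag_mx !mulmxA sqK mul1mx.
  by rewrite /AG mulmxA -e mulmxK.
(* X has operator norm at most 2 s1, as 2 s1^2 + 2 s1^2 / 100 <= 4 s1^2. Balancedness then bounds
   the squared operator norms of A and B by 2 s1. *)
have opX (u : 'cV_m) : sqn (X^T *m u) <= (2 * s1) ^+ 2 * sqn u.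
  have -> : X^T *m u = Xs^T *m u + (X - Xs)^T *m u.
    by rewrite -mulmxDl -linearD /= addrC subrK.
  apply: le_trans (sqnD_le _ _) _.
  have h1 := sqn_svd_tr_mul_le u (ltW s10).
  have h2 := sqn_mulmx_le (X - Xs)^T u; rewrite [sqn (X - Xs)^T]sqn_tr in h2.
  have h3 := ler_wpM2r (sqn_ge0 u) hD.
  have h4 : sr ^+ 2 <= s1 ^+ 2 by rewrite ler_pXn2r ?nnegrE ?(ltW sr_gt0) ?(ltW s10).
  have h5 := ler_wpM2r (sqn_ge0 u) h4.
  rewrite -/Xs in h1.
  have h6 := mulr_ge0 (sqr_ge0 s1) (sqn_ge0 u).
  by rewrite exprMn; nra.
have opA : forall v : 'cV_r, sqn (A *m v) <= 2 * s1 * sqn v.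
  by apply: (sqn_balanced_factor_le AB _ opX); rewrite mulr_ge0 // ltW.
have opB (v : 'cV_r) : sqn (B *m v) <= 2 * s1 * sqn v.
  by apply: le_trans (opA v); rewrite /sqn !inner_mulmxl !mulmxA AB.
exists AG, BG, Q; split => //.
- rewrite mulmxBr /As /sqrt_factor trmx_mul tr_diag_mx -!mulmxA UAG.
  by rewrite (mulmxA U^T) UU mul1mx subrr.
- split=> [i|j].
    (* The product AG BG^T = A B^T trades a row of AG for B applied to the same row of A: [BGlow]
       costs 2 / sr and [opB] costs 2 s1. *)
    have e : row i AG = row i A *m invmx H^T by rewrite row_mul.
    have := BGlow _ (row i AG).
    have -> : row i AG *m BG^T = (B *m (row i A)^T)^T.
      by rewrite -row_mul -XG /X row_mul trmx_mul trmxK.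
    have := opB (row i A)^T; rewrite !sqn_tr.
    move=> h1 h2; rewrite -(ler_pM2l sr_gt0).
    have -> : sr * (4 * (s1 / sr) * sqn (row i A)) = 4 * s1 * sqn (row i A).
      by field; rewrite gt_eqF.
    by lra.
  rewrite -(ler_pM2l sr_gt0).
  have -> : sr * (4 * (s1 / sr) * sqn (row j B)) = 4 * s1 * sqn (row j B).
    by field; rewrite gt_eqF.
  have -> : row j BG = row j B *m A^T *m U *m isq.
    by rewrite BGH row_mul /H /Q !mulmxA.
  apply: le_trans (isq_le _ _) _.
  rewrite -sqn_tr trmx_mul; apply: le_trans (sqn_isometry_tr_le _ UU) _.
  rewrite sqn_tr -sqn_tr trmx_mul trmxK; apply: le_trans (opA _) _.
  rewrite sqn_tr; have := mulr_ge0 (ltW s10) (sqn_ge0 (row j B)); lra.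
Qed.

End Svd.

End Alignment.

(** * Deterministic recovery *)

Section Hadamard.
Context {R : realType}.

(* Rows of [face_split A B] are the Kronecker products of the rows of [A] and
   [B]; it factors the entrywise product of two matrix products. *)
Definition face_split m r t (A : 'M[R]_(m, r)) (B : 'M[R]_(m, t)) : 'M[R]_(m, r * t) :=
  \matrix_i mxvec ((row i A)^T *m row i B).

Lemma sum_mxvec r t (F : 'I_(r * t) -> R) :
  \sum_c F c = \sum_k \sum_l F (mxvec_index k l).
Proof.
rewrite pair_big /= (reindex _ (curry_mxvec_bij _ _)).
by apply: eq_bigr => -[k l].
Qed.

Lemma face_splitE m r t (A : 'M[R]_(m, r)) (B : 'M[R]_(m, t)) i k l :
  face_split A B i (mxvec_index k l) = A i k * B i l.
Proof. by rewrite mxE mxvecE mxE big_ord1 !mxE. Qed.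

Lemma mul_face_split m n r t (A : 'M[R]_(m, r)) (A' : 'M[R]_(m, t))
    (B : 'M[R]_(n, r)) (B' : 'M[R]_(n, t)) i j :
  (face_split A A' *m (face_split B B')^T) i j = (A *m B^T) i j * (A' *m B'^T) i j.
Proof.
rewrite mxE sum_mxvec !mxE mulr_suml; apply: eq_bigr => k _.
rewrite mulr_sumr; apply: eq_bigr => l _.
by rewrite [X in _ * X]mxE !face_splitE !mxE; ring.
Qed.

Lemma sqn_face_split m r t (A : 'M[R]_(m, r)) (B : 'M[R]_(m, t)) :
  sqn (face_split A B) = \sum_i sqn (row i A) * sqn (row i B).
Proof.
rewrite sqnE; apply: eq_bigr => i _; rewrite sum_mxvec !sqnE !big_ord1 mulr_suml.
apply: eq_bigr => k _; rewrite mulr_sumr; apply: eq_bigr => l _.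
by rewrite face_splitE exprMn !mxE.
Qed.

Lemma sqn_face_split_le m r t (A : 'M[R]_(m, r)) (B : 'M[R]_(m, t)) b :
  (forall i, sqn (row i B) <= b) -> sqn (face_split A B) <= b * sqn A.
Proof.
move=> hb; rewrite sqn_face_split (sqn_row_sum A) mulr_sumr.
by apply: ler_sum => i _; rewrite mulrC ler_wpM2r // sqn_ge0.
Qed.

(** Rewrite the left side as <W^T F, G>, apply Cauchy-Schwarz, and use the operator bound on each
    column of F. *)
Lemma inner_mul_tr_le m n q (W : 'M[R]_(m, n)) (T : R)
    (F : 'M[R]_(m, q)) (G : 'M[R]_(n, q)) :
  (forall x : 'cV_m, sqn (W^T *m x) <= T * sqn x) ->
  inner W (F *m G^T) ^+ 2 <= T * sqn F * sqn G.
Proof.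
move=> hW.
have -> : inner W (F *m G^T) = inner (W^T *m F) G.
  by rewrite innerC inner_mulmxr inner_mulmxl !trmxK.
apply: le_trans (inner_sqr_le _ _) _; rewrite ler_wpM2r ?sqn_ge0 //.
rewrite -sqn_tr sqn_row_sum -(sqn_tr F) [X in _ * X]sqn_row_sum mulr_sumr.
apply: ler_sum => c _; rewrite -!tr_col !sqn_tr colE -mulmxA -colE; exact: hW.
Qed.

(** For the centered sampling matrix W this is the deviation of <P_Om X, P_Om Y> from p <X, Y>. *)
Definition hadamard_sum m n (W X Y : 'M[R]_(m, n)) : R :=
  \sum_i \sum_j W i j * (X i j * Y i j).

(** The entrywise product factors through face splittings that pair A with A' and B' with B. The row
    bounds absorb the primed factors and leave the Frobenius norms of the others. *)
Lemma hadamard_sum_le m n r (W : 'M[R]_(m, n)) (T a b : R)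
    (A A' : 'M[R]_(m, r)) (B B' : 'M[R]_(n, r)) :
  (forall x : 'cV_m, sqn (W^T *m x) <= T * sqn x) -> 0 <= T ->
  (forall i, sqn (row i A') <= a) -> (forall j, sqn (row j B') <= b) ->
  0 <= a ->
  hadamard_sum W (A *m B'^T) (A' *m B^T) ^+ 2 <= T * (a * b) * (sqn A * sqn B).
Proof.
move=> hW T0 ha hb a0.
have -> : hadamard_sum W (A *m B'^T) (A' *m B^T) =
    inner W (face_split A A' *m (face_split B' B)^T).
  by rewrite innerE; do 2!apply: eq_bigr => ? _; rewrite mul_face_split.
apply: le_trans (inner_mul_tr_le _ _ hW) _.
have -> : sqn (face_split B' B) = sqn (face_split B B').
  by rewrite !sqn_face_split; apply: eq_bigr => ? _; rewrite mulrC.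
have h1 := sqn_face_split_le A ha; have h2 := sqn_face_split_le B hb.
rewrite -mulrA -[leRHS]mulrA ler_wpM2l //.
have -> : a * b * (sqn A * sqn B) = (a * sqn A) * (b * sqn B) by ring.
by apply: ler_pM => //; exact: sqn_ge0.
Qed.

End Hadamard.

Lemma sqn_proj_obs {R : realType} m n p Om (X : 'M[R]_(m, n)) :
  sqn (proj_obs Om X) = p * sqn X + hadamard_sum (centered_mx p Om) X X.
Proof.
rewrite !sqnE /hadamard_sum mulr_sumr -big_split; apply: eq_bigr => i _ /=.
rewrite mulr_sumr -big_split; apply: eq_bigr => j _ /=.
by rewrite !mxE /centered; case: ifP => _ /=; ring.
Qed.

(** * Recovery from stationarity and small sampling errors *)

Section Recovery.
Context {R : realType} {m n r : nat} (p : R) (Om : {set 'I_m * 'I_n}).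
Context (As AG : 'M[R]_(m, r)) (Bs BG : 'M[R]_(n, r)) (sr e T a b K kap : R).

Let W := centered_mx p Om.
Let S := proj_obs Om (AG *m BG^T - As *m Bs^T).
Let dA := AG - As.
Let dB := BG - Bs.
Let M := dA *m Bs^T + As *m dB^T.
Let Z := dA *m dB^T.

Hypotheses (p_gt0 : 0 < p) (sr_gt0 : 0 < sr) (kap_ge1 : 1 <= kap) (K_ge0 : 0 <= K).
Hypotheses (T_ge0 : 0 <= T) (a_ge0 : 0 <= a) (b_ge0 : 0 <= b) (e_ge0 : 0 <= e).
Hypothesis SB : S *m BG = 0.
Hypothesis SA : S^T *m AG = 0.
Hypothesis orth : As^T *m dA = 0.
Hypothesis dB_small : 100 * sqn dB <= sr.
Hypothesis As_low : forall k (Y : 'M[R]_(k, r)), sr * sqn Y <= sqn (Y *m As^T).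
Hypothesis Bs_low : forall k (Y : 'M[R]_(k, r)), sr * sqn Y <= sqn (Y *m Bs^T).
Hypothesis As_row : forall i, sqn (row i As) <= a.
Hypothesis Bs_row : forall j, sqn (row j Bs) <= b.
Hypothesis dA_row : forall i, sqn (row i dA) <= K * kap * a.
Hypothesis dB_row : forall j, sqn (row j dB) <= K * kap * b.
Hypothesis W_op : forall x : 'cV_m, sqn (W^T *m x) <= T * sqn x.
Hypothesis W_row : forall i (v : 'rV_r),
  - (e * sqn v) <= \sum_j W i j * ((v *m Bs^T) 0 j) ^+ 2.
Hypothesis W_col : forall j (v : 'rV_r),
  - (e * sqn v) <= \sum_i W i j * ((v *m As^T) 0 i) ^+ 2.
Hypothesis T_le : T * kap ^+ 2 * (a * b) <= e ^+ 2.
Hypothesis e_le : e * (2 + 2 * K) <= p * sr / 4.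

Let diffE : AG *m BG^T - As *m Bs^T = M + Z.
Proof.
rewrite -[AG](subrK As) -[BG](subrK Bs) -/dA -/dB /M /Z.
move: (dA) (dB) => X Y; rewrite [(Y + _)^T]linearD /= mulmxDl !mulmxDr.
by rewrite addrA addrK -addrA addrC.
Qed.

(* Stationarity gives [<P(M + Z), M + 2Z> = 0], that is,
   [|PM + 3/2 PZ|^2 = 1/4 |PZ|^2]. *)
Let observed_first_order_le : sqn (proj_obs Om M) <= 4 * sqn (proj_obs Om Z).
Proof.
have projD (X Y : 'M[R]_(m, n)) : proj_obs Om (X + Y) = proj_obs Om X + proj_obs Om Y.
  by apply/matrixP => i j; rewrite !mxE; case: ifP; rewrite ?addr0.
have tangent : M + (Z + Z) = dA *m BG^T + AG *m dB^T.
  rewrite -[AG](subrK As) -[BG](subrK Bs) -/dA -/dB /M /Z.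
  move: (dA) (dB) => X Y; rewrite [(Y + _)^T]linearD /= mulmxDr mulmxDl.
  by rewrite [RHS]addrACA addrC.
have : inner S (M + (Z + Z)) = 0.
  rewrite tangent innerDr innerC inner_mulmxr trmxK SB.
  rewrite (innerC S) inner_mulmxl -[AG^T *m S]trmxK trmx_mul trmxK SA.
  by rewrite trmx0 /inner !mulmx0 !mxtrace0 addr0.
rewrite /S diffE -inner_proj_obs (projD M (Z + Z)) (projD M Z) (projD Z Z).
move: (proj_obs Om M) (proj_obs Om Z) => X Y.
rewrite !innerDl !innerDr (innerC Y X) -!/(sqn _) => h.
have := sqn_ge0 (X + (Y + Y)).
rewrite !sqnD !innerDr -!/(sqn _); lra.
Qed.

(** The cross term of M vanishes because As^T dA = 0, and each remaining term is bounded below by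
    the least singular value of Bs or As. *)
Let sqnM : sr * (sqn dA + sqn dB) <= sqn M.
Proof.
have -> : sqn M = sqn (dA *m Bs^T) + sqn (dB *m As^T).
  rewrite /M sqnD -(sqn_tr (As *m _)) trmx_mul trmxK.
  have -> : inner (dA *m Bs^T) (As *m dB^T) = 0.
    by rewrite innerC inner_mulmxl mulmxA orth mul0mx /inner mulmx0 mxtrace0.
  by rewrite mulr0 addr0.
by rewrite mulrDr lerD.
Qed.

(** AM-GM in the form 4xy <= (x + y)^2. *)
Let abs_le_half x y z : 0 <= x -> 0 <= y -> 0 <= z ->
  forall c : R, c ^+ 2 <= z ^+ 2 * (x * y) -> 2 * `|c| <= z * (x + y).
Proof.
move=> x0 y0 z0 c hc.
rewrite -(@ler_pXn2r _ 2) ?nnegrE ?mulr_ge0 ?addr_ge0 //.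
rewrite !exprMn real_normK ?num_real //.
have := mulr_ge0 (sqr_ge0 z) (sqr_ge0 (x - y)).
have -> : z ^+ 2 * (x - y) ^+ 2 = z ^+ 2 * (x + y) ^+ 2 - 4 * (z ^+ 2 * (x * y)) by ring.
lra.
Qed.

Lemma factors_recovered : dA = 0 /\ dB = 0.
Proof.
have A0 := sqn_ge0 dA; have B0 := sqn_ge0 dB.
set x := sqn dA in A0 *; set y := sqn dB in B0 *.
have row_part : - (e * x) <= hadamard_sum W (dA *m Bs^T) (dA *m Bs^T).
  rewrite /x (sqn_row_sum dA) mulr_sumr -sumrN; apply: ler_sum => i _.
  apply: le_trans (W_row i _) _; apply: ler_sum => j _.
  by rewrite -row_mul !mxE expr2.
have col_part : - (e * y) <= hadamard_sum W (As *m dB^T) (As *m dB^T).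
  rewrite /hadamard_sum exchange_big /y (sqn_row_sum dB) mulr_sumr -sumrN.
  apply: ler_sum => j _.
  apply: le_trans (W_col j _) _; apply: ler_sum => i _.
  by rewrite -row_mul -[As *m _]trmxK trmx_mul trmxK !mxE expr2.
have Tab : T * (a * b) <= e ^+ 2.
  apply: le_trans T_le; rewrite -mulrA ler_wpM2l //.
  by rewrite ler_peMl ?mulr_ge0 // exprn_ege1.
have xy0 : 0 <= x * y by exact: mulr_ge0.
have cross : 2 * `|hadamard_sum W (dA *m Bs^T) (As *m dB^T)| <= e * (x + y).
  apply: abs_le_half => //; apply: le_trans (hadamard_sum_le _ _ _ T_ge0 As_row Bs_row a_ge0) _ => //.
  by rewrite ler_wpM2r.
(* The rows of dA and dB are bounded only up to K kap, whence the factor kap^2 in [T_le]. *)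
have second : 2 * `|hadamard_sum W Z Z| <= e * K * (x + y).
  apply: abs_le_half; rewrite ?mulr_ge0 //.
  have kap0 : 0 <= kap := le_trans ler01 kap_ge1.
  apply: le_trans (hadamard_sum_le _ _ _ T_ge0 dA_row dB_row _) _ => //.
    by rewrite !mulr_ge0.
  rewrite ler_wpM2r //.
  have -> : T * (K * kap * a * (K * kap * b)) = K ^+ 2 * (T * kap ^+ 2 * (a * b)) by ring.
  by rewrite exprMn mulrC ler_wpM2r ?sqr_ge0.
have MM : hadamard_sum W M M = hadamard_sum W (dA *m Bs^T) (dA *m Bs^T) +
    hadamard_sum W (As *m dB^T) (As *m dB^T) +
    2 * hadamard_sum W (dA *m Bs^T) (As *m dB^T).
  have ME i j : M i j = (dA *m Bs^T) i j + (As *m dB^T) i j by rewrite mxE.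
  rewrite /hadamard_sum mulr_sumr -!big_split; apply: eq_bigr => i _ /=.
  rewrite mulr_sumr -!big_split; apply: eq_bigr => j _ /=.
  by rewrite ME; ring.
have := observed_first_order_le.
rewrite !(sqn_proj_obs p) -/W MM => obs.
have hM := ler_wpM2l (ltW p_gt0) sqnM; rewrite -/x -/y in hM.
have hZ : 100 * (p * sqn Z) <= p * (sr * x).
  have h1 := sqn_mulmx_le dA dB^T; rewrite sqn_tr -/x -/y in h1.
  have h2 := ler_wpM2l A0 dB_small; rewrite -/y in h2.
  have := ler_wpM2l (ltW p_gt0) (_ : 100 * sqn Z <= sr * x).
  rewrite mulrCA; apply; rewrite /Z; lra.
have psr0 : 0 < p * sr by rewrite mulr_gt0.
have he := ler_wpM2r (addr_ge0 A0 B0) e_le.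
have c1 := ler_norm (- hadamard_sum W (dA *m Bs^T) (As *m dB^T)).
have c2 := ler_norm (hadamard_sum W Z Z); rewrite normrN in c1.
have xs := mulr_ge0 (ltW psr0) A0; have ys := mulr_ge0 (ltW psr0) B0.
(* p |M|^2 is at most 4p |Z|^2 <= p sr x / 25, plus 2e(x + y) from the sampling error of M and 2eK(x
   + y) from that of Z. By [e_le] these errors are at most p sr (x + y) / 4, while p |M|^2 >= p sr
   (x + y). *)
have small : p * sr * (x + y) <= 0 by lra.
have xy : x + y <= 0 by rewrite -(pmulr_rle0 _ psr0).
by split; apply/eqP; rewrite -sqn_eq0 eq_le sqn_ge0 andbT; lra.
Qed.

End Recovery.

(** * Concentration of the row and column forms *)

Section QuadraticForms.
Context {R : realType} {E : finType} {n r : nat} (p : R).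
Context (phi : 'I_n -> E) (B : 'M[R]_(n, r)) (b : R).
Hypothesis phi_inj : injective phi.
Hypothesis B_row : forall j, sqn (row j B) <= b.

(** Here [phi] embeds a row or a column into the set of all entries. The products B_jk B_jl are
    extended by zero off its image, so that the Chernoff bound over all entries applies. *)
Definition pair_test k l e : R := \sum_(j | phi j == e) B j k * B j l.

Let pair_test_phi k l j : pair_test k l (phi j) = B j k * B j l.
Proof. by rewrite /pair_test (big_pred1 j) // => j'; rewrite inj_eq. Qed.

Let sum_pair_test k l (w : E -> R) :
  \sum_e pair_test k l e * w e = \sum_j B j k * B j l * w (phi j).
Proof.
rewrite [RHS](partition_big phi predT) //=; apply: eq_bigr => e _.
by rewrite mulr_suml; apply: eq_bigr => j /eqP ->.
Qed.

Let B_entry j k : B j k ^+ 2 <= b.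
Proof.
apply: le_trans (B_row j); rewrite sqnE big_ord1 (bigD1 k) //= mxE lerDl.
by apply: sumr_ge0 => *; exact: sqr_ge0.
Qed.

Let norm_pair_test k l e : 0 <= b -> `|pair_test k l e| <= b.
Proof.
move=> b0; have [/existsP[j /eqP <-]|/existsPn none] := boolP [exists j, phi j == e].
  rewrite pair_test_phi ler_norml.
  have h1 := B_entry j k; have h2 := B_entry j l.
  have h3 := sqr_ge0 (B j k - B j l); have h4 := sqr_ge0 (B j k + B j l).
  by apply/andP; split; nra.
by rewrite /pair_test big1 ?normr0 // => j; rewrite (negbTE (none j)).
Qed.

(** The added [dl] keeps the variance proxy positive, and large enough for the Chernoff condition 2
    b^2 L <= p v. *)
Definition pair_variance (dl : R) k l : R := \sum_j (B j k * B j l) ^+ 2 + dl.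

Definition form_witness (dl L : R) Om : R :=
  \sum_k \sum_l chernoff_witness p (pair_test k l) (pair_variance dl k l) L Om.

Let pair_variance_gt0 dl k l : 0 < dl -> 0 < pair_variance dl k l.
Proof. by move=> dl0; apply: ltr_wpDl => //; apply: sumr_ge0 => *; exact: sqr_ge0. Qed.

Lemma form_witness_ge0 dl L Om : 0 <= form_witness dl L Om.
Proof. by do 2!apply: sumr_ge0 => ? _; exact: chernoff_witness_ge0. Qed.

Lemma expectation_form_witness dl L :
  0 < p <= 1 -> 0 < dl -> 0 <= L -> 0 <= b -> 2 * b ^+ 2 * L <= p * dl ->
  expectation p (form_witness dl L) <= r%:R ^+ 2 * (2 * expR (- L)).
Proof.
move=> /andP[p0 p1] dl0 L0 b0 hb.
have -> : r%:R ^+ 2 * (2 * expR (- L)) = \sum_(k < r) \sum_(l < r) (2 * expR (- L)) :> R.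
  by rewrite !sumr_const !card_ord -mulrnA -[RHS]mulr_natl natrM expr2.
rewrite /form_witness expectation_sum; apply: ler_sum => k _.
rewrite expectation_sum; apply: ler_sum => l _.
have var_le : \sum_j (B j k * B j l) ^+ 2 <= pair_variance dl k l by rewrite lerDl ltW.
apply: (@expectation_chernoff_witness _ _ _ _ _ _ _ b) => //.
- by rewrite (ltW p0).
- exact: pair_variance_gt0.
- by move=> e; exact: norm_pair_test.
- under eq_bigr do rewrite expr2.
  rewrite sum_pair_test; apply: le_trans var_le.
  by apply: ler_sum => j _; rewrite pair_test_phi -expr2.
- apply: le_trans hb _; rewrite ler_wpM2l ?(ltW p0) // lerDr.
  by apply: sumr_ge0 => *; exact: sqr_ge0.
Qed.

(** For fixed j, the sum over k and l of (B_jk B_jl)^2 is |row j B|^4 <= b |row j B|^2. *)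
Let sum_pair_variance dl :
  \sum_k \sum_l pair_variance dl k l <= b * sqn B + r%:R ^+ 2 * dl.
Proof.
under eq_bigr do rewrite big_split /=.
rewrite big_split /=; apply: lerD; last first.
  by rewrite !sumr_const !card_ord -mulrnA -[leLHS]mulr_natl natrM expr2.
under eq_bigr do rewrite exchange_big /=.
rewrite exchange_big /= (sqn_row_sum B) mulr_sumr; apply: ler_sum => j _.
apply: (@le_trans _ _ (sqn (row j B) * sqn (row j B))); last first.
  by rewrite ler_wpM2r // sqn_ge0.
rewrite [in leRHS]sqnE big_ord1 mulr_suml; apply: ler_sum => k _.
rewrite mulr_sumr; apply: ler_sum => l _; by rewrite exprMn !mxE.
Qed.

(** The form is <v^T v, M> for an r by r matrix M. Cauchy-Schwarz bounds its square by |v|^4 |M|^2,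
    and a total witness below 1 bounds every entry of M at once. *)
Lemma quadratic_form_ge dl L e Om :
  0 < p -> 0 < dl -> 0 < L -> 0 <= e ->
  8 * p * L * (b * sqn B + r%:R ^+ 2 * dl) <= e ^+ 2 ->
  form_witness dl L Om < 1 ->
  forall v : 'rV_r,
    - (e * sqn v) <= \sum_j centered p Om (phi j) * ((v *m B^T) 0 j) ^+ 2.
Proof.
move=> p0 dl0 L0 e0 he hf v.
pose Mkl k l : R := \sum_e pair_test k l e * centered p Om e.
have Mle k l : Mkl k l ^+ 2 <= 8 * p * L * pair_variance dl k l.
  rewrite mulrAC; apply: chernoff_witness_lt1 => //; first exact: pair_variance_gt0.
  apply: le_lt_trans hf; rewrite /form_witness (bigD1 k) //= (bigD1 l) //= -addrA lerDl.
  by rewrite addr_ge0 //; [|apply: sumr_ge0 => ? _];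
    apply: sumr_ge0 => ? _; exact: chernoff_witness_ge0.
have -> : \sum_j centered p Om (phi j) * ((v *m B^T) 0 j) ^+ 2 =
    \sum_(kl : 'I_r * 'I_r) (v 0 kl.1 * v 0 kl.2) * Mkl kl.1 kl.2.
  rewrite -(pair_big predT predT (fun k l => (v 0 k * v 0 l) * Mkl k l)) /=.
  transitivity (\sum_j \sum_k \sum_l
      v 0 k * v 0 l * (B j k * B j l * centered p Om (phi j))).
    apply: eq_bigr => j _; rewrite mxE expr2 mulr_suml mulr_sumr.
    apply: eq_bigr => k _; rewrite mulr_sumr mulr_sumr; apply: eq_bigr => l _.
    by rewrite !mxE; ring.
  rewrite exchange_big; apply: eq_bigr => k _.
  rewrite exchange_big; apply: eq_bigr => l _.
  by rewrite /Mkl sum_pair_test mulr_sumr.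
set Y := \sum_kl _.
have : Y ^+ 2 <= (e * sqn v) ^+ 2.
  apply: le_trans (sum_mul_sqr_le _ _) _.
  have -> : \sum_(kl : 'I_r * 'I_r) (v 0 kl.1 * v 0 kl.2) ^+ 2 = sqn v ^+ 2.
    rewrite -(pair_big predT predT (fun k l => (v 0 k * v 0 l) ^+ 2)) /=.
    rewrite sqnE big_ord1 [RHS]expr2 mulr_suml; apply: eq_bigr => k _.
    by rewrite mulr_sumr; apply: eq_bigr => l _; rewrite exprMn.
  rewrite exprMn [leRHS]mulrC ler_wpM2l ?sqr_ge0 //; apply: le_trans he.
  apply: le_trans (ler_wpM2l _ (sum_pair_variance dl)); last first.
    by rewrite !mulr_ge0 // ltW.
  rewrite -(pair_big predT predT (fun k l => Mkl k l ^+ 2)) /= mulr_sumr.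
  by apply: ler_sum => k _; rewrite mulr_sumr; apply: ler_sum.
rewrite -[Y ^+ 2]real_normK ?num_real // ler_pXn2r ?nnegrE ?mulr_ge0 ?sqn_ge0 //.
by rewrite ler_norml => /andP[].
Qed.

End QuadraticForms.

(** Repeated squaring reaches only powers of two, so the moment order is rounded up to one;
    minimality keeps it below 2x. *)
Lemma exists_pow2_between {R : realType} (x : R) :
  1 <= x -> exists a : nat, x <= (2 ^ a)%:R <= 2 * x.
Proof.
move=> x1; have ex : exists a : nat, x <= (2 ^ a)%:R.
  exists (Num.bound x); rewrite natrX; exact/ltW/upper_nthrootP.
case: (ex_minnP ex) => a xa amin; exists a; rewrite xa /=.
case: a xa amin => [|a] xa amin; first by rewrite expn0; lra.
have : (2 ^ a)%:R < x.
  by rewrite ltNge; apply/negP => /amin; rewrite ltnn.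
rewrite expnS natrM; lra.
Qed.

Lemma trace_gram_pow2_ge0 {R : realType} m n (W : 'M[R]_(m, n)) a :
  0 <= \tr ((W *m W^T) ^+ (2 ^ a)).
Proof.
case: a => [|a].
  have := sqn_ge0 W^T; by rewrite /sqn /inner trmxK expr1.
have := sqn_ge0 ((W *m W^T) ^+ (2 ^ a)).
by rewrite /sqn /inner trmx_exp trmx_mul trmxK mulmxE -exprD expnS mul2n addnn.
Qed.

Section RowNorms.
Context {R : realType}.

Lemma sigmaE r (s : 'rV[R]_r) (k : 'I_r) : sigma s k.+1 = s 0 k.
Proof. by rewrite /sigma (nth_map k) ?size_enum_ord //= nth_ord_enum. Qed.

Lemma norm2inf_row_le m r (A : 'M[R]_(m, r)) y i :
  norm2inf A <= y -> sqn (row i A) <= y ^+ 2.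
Proof.
move=> Ay; have h : Num.sqrt (\sum_j A i j ^+ 2) <= y.
  by apply: le_trans Ay; exact: le_bigmax.
have -> : sqn (row i A) = Num.sqrt (\sum_j A i j ^+ 2) ^+ 2.
  rewrite sqr_sqrtr ?sqnE ?big_ord1; first by apply: eq_bigr => j _; rewrite mxE.
  by apply: sumr_ge0 => *; exact: sqr_ge0.
by rewrite ler_pXn2r ?nnegrE ?sqrtr_ge0 // (le_trans (sqrtr_ge0 _) h).
Qed.

End RowNorms.

(** * Recovery on a good sample *)

Section GoodSample.
Context {R : realType} {m n r : nat} (c2 mu : R) (Xs : 'M[R]_(m, n)).
Context (U : 'M[R]_(m, r)) (s : 'rV[R]_r) (V : 'M[R]_(n, r)).
Hypotheses (m_gt0 : (0 < m)%N) (n_gt0 : (0 < n)%N) (r_gt0 : (0 < r)%N).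
Hypothesis Xs_svd : compact_svd Xs U s V.
Hypothesis Xs_incoherent : incoherent mu U s V.

Let s1 := sigma s 1.
Let sr := sigma s r.
Let As := sqrt_factor U s.
Let Bs := sqrt_factor V s.
Definition row_energy (k : nat) : R := s1 * (mu * r%:R / k%:R).
Let a := row_energy m.
Let b := row_energy n.

Lemma sigma_bounds : 0 < sr /\ forall k, sr <= s 0 k <= s1.
Proof.
case: Xs_svd => _ _ spos smono _.
have r1 : (r.-1 < r)%N by rewrite prednK.
have -> : sr = s 0 (Ordinal r1).
  by rewrite -sigmaE /= prednK.
have -> : s1 = s 0 (Ordinal r_gt0) by rewrite -sigmaE.
split=> // k; apply/andP; split; apply: smono => //=.
by rewrite -ltnS prednK.
Qed.

Lemma sigma_le : 0 < sr /\ sr <= s1.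
Proof.
have [sr0 sb] := sigma_bounds; split=> //.
by have /andP[h1 h2] := sb (Ordinal r_gt0); exact: le_trans h2.
Qed.

Let row_bound_sqr k : 0 <= row_energy k -> row_bound k mu s ^+ 2 = row_energy k.
Proof. by move=> ?; rewrite /row_bound sqr_sqrtr. Qed.

Let sqn_sqrt_factor_ge k (P : 'M[R]_(k, r)) : P^T *m P = 1%:M ->
  sr * r%:R <= sqn (sqrt_factor P s).
Proof.
move=> PP; have [sr0 sb] := sigma_bounds.
have := sqn_mul_sqrt_factor_ge PP sr0 sb 1%:M.
rewrite mul1mx sqn_tr; congr (_ * _ <= _).
by rewrite /sqn /inner trmx1 mulmx1 mxtrace1.
Qed.

(** For mu <= 0 the row bound is the square root of a nonpositive number, which is 0 by convention.
    Then As = 0, contradicting sr r <= |As|^2. *)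
Lemma incoherence_gt0 : 0 < mu.
Proof.
have [sr0 sb] := sigma_bounds; case: Xs_svd => UU _ _ _ _.
case: Xs_incoherent => hA _.
have h := sqn_sqrt_factor_ge UU.
rewrite ltNge; apply/negP => mu0.
have rb0 : row_bound m mu s = 0.
  apply: ler0_sqrtr; apply: mulr_ge0_le0.
    by have [h1 h2] := sigma_le; rewrite (le_trans (ltW h1)).
  by rewrite -mulrA mulr_le0_ge0 // divr_ge0.
have : sqn As <= 0.
  rewrite sqn_row_sum sumr_le0 // => i _.
  by have := norm2inf_row_le i hA; rewrite rb0 expr0n.
apply/negP; rewrite -ltNge; apply: lt_le_trans h.
by rewrite mulr_gt0 // ltr0n.
Qed.

Lemma row_energy_gt0 k : (0 < k)%N -> 0 < row_energy k.
Proof.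
move=> k0; have [h1 h2] := sigma_le.
rewrite /row_energy mulr_gt0 ?(lt_le_trans h1 h2) // divr_gt0 ?ltr0n //.
by rewrite mulr_gt0 ?ltr0n ?incoherence_gt0.
Qed.

Lemma As_row_le i : sqn (row i As) <= a.
Proof.
case: Xs_incoherent => hA _; rewrite /a -row_bound_sqr ?(ltW (row_energy_gt0 m_gt0)) //.
exact: norm2inf_row_le.
Qed.

Lemma Bs_row_le j : sqn (row j Bs) <= b.
Proof.
case: Xs_incoherent => _ hB; rewrite /b -row_bound_sqr ?(ltW (row_energy_gt0 n_gt0)) //.
exact: norm2inf_row_le.
Qed.

Lemma sqn_As_le : sqn As <= s1 * mu * r%:R.
Proof.
have -> : s1 * mu * r%:R = \sum_(i < m) a.
  rewrite sumr_const card_ord -mulr_natl /a /row_energy; field.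
  by rewrite pnatr_eq0 -lt0n.
by rewrite sqn_row_sum; apply: ler_sum => i _; exact: As_row_le.
Qed.

Lemma sqn_Bs_le : sqn Bs <= s1 * mu * r%:R.
Proof.
have -> : s1 * mu * r%:R = \sum_(i < n) b.
  rewrite sumr_const card_ord -mulr_natl /b /row_energy; field.
  by rewrite pnatr_eq0 -lt0n.
by rewrite sqn_row_sum; apply: ler_sum => i _; exact: Bs_row_le.
Qed.

(** Compare the two bounds sr r <= |As|^2 <= s1 mu r. *)
Lemma kappa_incoherence_ge1 : 1 <= mu * kappa s.
Proof.
case: Xs_svd => UU _ _ _ _; have := le_trans (sqn_sqrt_factor_ge UU) sqn_As_le.
have [sr0 _] := sigma_le; rewrite ler_pM2r ?ltr0n // => h.
by rewrite /kappa -/s1 -/sr mulrA ler_pdivlMr // mul1r mulrC.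
Qed.

Lemma kappa_ge1 : 1 <= kappa s.
Proof. by have [sr0 h] := sigma_le; rewrite /kappa -/s1 -/sr ler_pdivlMr ?mul1r. Qed.

Lemma good_sample_recovers (p e T : R) (Om : {set 'I_m * 'I_n}) :
  let K := 8 * c2 ^+ 2 + 2 in
  0 < p -> 0 <= e -> 0 <= T ->
  (forall x : 'cV_m, sqn ((centered_mx p Om)^T *m x) <= T * sqn x) ->
  (forall i (v : 'rV_r), - (e * sqn v) <=
    \sum_j centered p Om (i, j) * ((v *m Bs^T) 0 j) ^+ 2) ->
  (forall j (v : 'rV_r), - (e * sqn v) <=
    \sum_i centered p Om (i, j) * ((v *m As^T) 0 i) ^+ 2) ->
  T * kappa s ^+ 2 * (a * b) <= e ^+ 2 ->
  e * (2 + 2 * K) <= p * sr / 4 ->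
  forall (A : 'M[R]_(m, r)) (B : 'M[R]_(n, r)),
    second_order_stationary (factored_loss p Om Xs) (A, B) ->
    local_region c2 mu Xs s (A *m B^T) -> A *m B^T = Xs.
Proof.
move=> K p0 e0 T0 Wop Wrow Wcol Tle ele A B sos [_ near [A' [B' [XE [bal hA' hB']]]]].
have [sr0 sb] := sigma_bounds; have [_ s1r] := sigma_le.
have [UU VV _ _ XsE] := Xs_svd.
have [SB SA] := stationary_residual (lt0r_neq0 p0) sos.
have kap1 := kappa_ge1.
have kap0 : 0 < kappa s := lt_le_trans ltr01 kap1.
have near2 : 100 * sqn (A' *m B'^T - U *m diag_mx s *m V^T) <= sr ^+ 2.
  rewrite -XsE -XE -frobenius_sqr.
  have near' : 10 * frobenius (A *m B^T - Xs) <= sr.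
    apply: (@le_trans _ _ ((kappa s)^-1 * sr)).
      move: near; rewrite -/sr; lra.
    by rewrite ler_piMl ?(ltW sr0) // invf_le1.
  have -> : 100 * frobenius (A *m B^T - Xs) ^+ 2 = (10 * frobenius (A *m B^T - Xs)) ^+ 2.
    by ring.
  by rewrite ler_pXn2r ?nnegrE ?mulr_ge0 ?sqrtr_ge0 ?(ltW sr0).
(* The alignment starts from the balanced pair (A', B') supplied by the local region, which may
   differ from the stationary pair (A, B); only their products agree. *)
have [AG [BG [Q [[XG BGE] inj orth dB [rowA rowB]]]]] :=
  aligned_factors UU VV sr0 sb s1r bal near2.
rewrite -XE in XG BGE.
have XsE' : Xs = As *m Bs^T by rewrite XsE; exact: (svd_sqrt_factor _ _ sr0 sb).
set S := proj_obs Om _ in SB SA.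
(* Stationarity passes to the aligned pair through the product alone: BG = X^T Q with X = A B^T, and
   S^T AG BG^T = S^T A B^T = 0 with BG^T injective. *)
have SBG : S *m BG = 0 by rewrite BGE trmx_mul trmxK !mulmxA SB !mul0mx.
have SAG : S^T *m AG = 0 by apply: inj; rewrite -mulmxA -XG mulmxA SA mul0mx.
(* Twice the alignment bound 4 c2^2 kap plus twice the incoherence bound 1 gives 8 c2^2 kap + 2 <= K
   kap. *)
have row_le k (P P' G : 'M[R]_(k, r)) i : (0 < k)%N ->
    norm2inf P' <= c2 * row_bound k mu s -> sqn (row i P) <= row_energy k ->
    sqn (row i G) <= 4 * (s1 / sr) * sqn (row i P') ->
    sqn (row i (G - P)) <= K * kappa s * row_energy k.
  move=> k0 hP' hP hG; have en0 := row_energy_gt0 k0.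
  have h1 := norm2inf_row_le i hP'; rewrite exprMn row_bound_sqr ?(ltW en0) // in h1.
  have h2 := ler_wpM2l (_ : 0 <= 4 * kappa s) h1.
  rewrite mulr_ge0 ?(ltW kap0) // in h2; have {}h2 := h2 isT.
  rewrite -/(kappa s) in hG.
  have -> : row i (G - P) = row i G + - row i P by apply/rowP => j; rewrite !mxE.
  apply: le_trans (sqnD_le _ _) _; rewrite sqnN.
  have h3 := ler_wpM2r (ltW en0) kap1.
  rewrite /K; lra.
have [dA0 dB0] : AG - As = 0 /\ BG - Bs = 0.
  apply: (@factors_recovered _ _ _ _ p Om As AG Bs BG sr e T a b K (kappa s)) => //.
  - by rewrite /K addr_ge0 // mulr_ge0 // sqr_ge0.
  - exact/ltW/row_energy_gt0.
  - exact/ltW/row_energy_gt0.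
  - by rewrite -XG -XsE'.
  - by rewrite -XG -XsE'.
  - by move=> k Y; exact: (sqn_mul_sqrt_factor_ge UU sr0 sb).
  - by move=> k Y; exact: (sqn_mul_sqrt_factor_ge VV sr0 sb).
  - exact: As_row_le.
  - exact: Bs_row_le.
  - by move=> i; apply: (row_le _ _ A') => //; exact: As_row_le.
  - by move=> j; apply: (row_le _ _ B') => //; exact: Bs_row_le.
  - by move=> i v; under eq_bigr do rewrite mxE; exact: Wrow.
  - by move=> j v; under eq_bigr do rewrite mxE; exact: Wcol.
by rewrite XG XsE' (subr0_eq dA0) (subr0_eq dB0).
Qed.

End GoodSample.

(** * Assembly *)

Lemma expR_opp_natl_ln {R : realType} (N : R) k :
  0 < N -> expR (- (k%:R * ln N)) = N ^- k.
Proof. by move=> N0; rewrite expRN expRM_natl lnK. Qed.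

(** From exp(-1/2) >= 1/2 one gets exp(1/2) <= 2 <= N. *)
Lemma ln_nat_ge_half {R : realType} (N : nat) : (2 <= N)%N -> 1 / 2 <= ln N%:R :> R.
Proof.
move=> N2; have N0 : 0 < N%:R :> R by rewrite ltr0n (leq_trans _ N2).
rewrite -ler_expR lnK //; have h := expR_ge1Dx (- (1 / 2) : R).
have e0 := expR_gt0 (- (1 / 2) : R).
have : expR (1 / 2 : R) * expR (- (1 / 2)) = 1 by rewrite -expRD subrr expR0.
have : 2 <= N%:R :> R by rewrite ler_nat.
nra.
Qed.

Section SampleComplexity.
Context {R : realType} (c2 : R).

Let K : R := 8 * c2 ^+ 2 + 2.
(** This makes e = tolerance p sr satisfy e (2 + 2K) = p sr / 4 exactly. *)
Definition tolerance : R := (8 + 8 * K)^-1.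
(** The quadratic forms require the constant 96 and the trace moment 64 exp 1; the sum serves
    both. *)
Definition oversampling : R := (96 + 64 * expR 1) * tolerance ^- 2.

Let K0 : 0 <= K. Proof. by rewrite /K addr_ge0 // mulr_ge0 ?sqr_ge0. Qed.

Lemma tolerance_gt0 : 0 < tolerance.
Proof. by have h := K0; rewrite /tolerance invr_gt0; lra. Qed.

Lemma tolerance_le1 : tolerance <= 1.
Proof. by have h := K0; rewrite /tolerance invf_le1; lra. Qed.

Let toleranceK : tolerance * (2 + 2 * K) = 1 / 4.
Proof. by rewrite /tolerance; field; have h := K0; apply: lt0r_neq0; lra. Qed.

Lemma oversampling_gt0 : 0 < oversampling.
Proof.
have e0 := expR_gt0 (1 : R).
by rewrite /oversampling mulr_gt0 ?invr_gt0 ?exprn_gt0 ?tolerance_gt0 //; lra.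
Qed.

Context {m n r : nat} (mu p : R) (Xs : 'M[R]_(m, n)).
Context (U : 'M[R]_(m, r)) (s : 'rV[R]_r) (V : 'M[R]_(n, r)).
Hypotheses (m_gt0 : (0 < m)%N) (n_gt0 : (0 < n)%N) (r_gt0 : (0 < r)%N).
Hypothesis r_le : (r <= minn m n)%N.
Hypothesis Xs_svd : compact_svd Xs U s V.
Hypothesis Xs_incoherent : incoherent mu U s V.
Hypothesis p_le1 : p <= 1.
Hypothesis p_ge : oversampling * (mu ^+ 2 * r%:R ^+ 2 * kappa s ^+ 4 * (m + n)%N%:R
              * ln (m + n)%N%:R / (m%:R * n%:R)) <= p.

Let N : R := (m + n)%:R.
Let L : R := ln N.
Let s1 := sigma s 1.
Let sr := sigma s r.
Let kap := kappa s.
Let As := sqrt_factor U s.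
Let Bs := sqrt_factor V s.
Let a := row_energy mu s m.
Let b := row_energy mu s n.
Let e := tolerance * p * sr.
(** The largest squared operator norm that the deterministic argument tolerates. *)
Let T := e ^+ 2 / (kap ^+ 2 * (a * b)).
Let rate := mu ^+ 2 * r%:R ^+ 2 * kap ^+ 4 * N * L / (m%:R * n%:R).

Let m0 : 0 < m%:R :> R. Proof. by rewrite ltr0n. Qed.
Let n0 : 0 < n%:R :> R. Proof. by rewrite ltr0n. Qed.
Let r1 : 1 <= r%:R :> R. Proof. by rewrite ler1n. Qed.
Let N_eq : N = m%:R + n%:R. Proof. exact: natrD. Qed.
Let N0 : 0 < N. Proof. by rewrite N_eq addr_gt0. Qed.

Let L_ge : 1 / 2 <= L.
Proof. by apply: ln_nat_ge_half; rewrite -addn1 leq_add. Qed.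

Let L0 : 0 < L. Proof. by apply: lt_le_trans L_ge. Qed.
Let mu0 : 0 < mu. Proof. exact: (incoherence_gt0 r_gt0 Xs_svd Xs_incoherent). Qed.
Let sr0 : 0 < sr. Proof. by have [] := sigma_le r_gt0 Xs_svd. Qed.
Let s10 : 0 < s1.
Proof. by have [h1 h2] := sigma_le r_gt0 Xs_svd; exact: lt_le_trans h2. Qed.
Let kap1 : 1 <= kap. Proof. exact: (kappa_ge1 r_gt0 Xs_svd). Qed.
Let kap0 : 0 < kap. Proof. exact: lt_le_trans kap1. Qed.
Let mukap1 : 1 <= mu * kap.
Proof. exact: (kappa_incoherence_ge1 m_gt0 r_gt0 Xs_svd Xs_incoherent). Qed.
Let s1E : s1 = kap * sr. Proof. by rewrite /kap /kappa divfK ?gt_eqF. Qed.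

Let rate0 : 0 < rate.
Proof.
have r0 : 0 < r%:R :> R by rewrite ltr0n.
rewrite /rate divr_gt0 ?(mulr_gt0 m0 n0) // mulr_gt0 // mulr_gt0 //.
by do 2!(rewrite mulr_gt0 ?exprn_gt0 //).
Qed.

Let p_rate C : 0 <= C -> C <= 96 + 64 * expR 1 -> C * rate <= tolerance ^+ 2 * p.
Proof.
move=> C0 hC; have t2 : 0 < tolerance ^+ 2 by rewrite exprn_gt0 ?tolerance_gt0.
have cancel (x y z : R) : x != 0 -> x * (y * x^-1 * z) = y * z by move=> ?; field.
have h : tolerance ^+ 2 * (oversampling * rate) <= tolerance ^+ 2 * p.
  by rewrite ler_wpM2l ?(ltW t2).
apply: le_trans h; rewrite /oversampling cancel ?gt_eqF //.
by rewrite ler_wpM2r // ltW.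
Qed.

Let p_rate1 C : 0 <= C -> C <= 96 + 64 * expR 1 -> C * rate <= p.
Proof.
move=> C0 hC; apply: le_trans (p_rate C0 hC) _.
have p0 : 0 <= p.
  by apply: le_trans p_ge; rewrite mulr_ge0 ?ltW ?oversampling_gt0 //.
by rewrite ler_piMl // exprn_ile1 ?tolerance_le1 // ltW // tolerance_gt0.
Qed.

Let e1_gt0 : 0 < expR 1 :> R. Proof. exact: expR_gt0. Qed.

Let p0 : 0 < p.
Proof.
have he := e1_gt0; have h : rate <= p by rewrite -[rate]mul1r p_rate1 //; lra.
exact: lt_le_trans h.
Qed.

Let a0 : 0 < a. Proof. exact: (row_energy_gt0 r_gt0 Xs_svd Xs_incoherent m_gt0). Qed.
Let b0 : 0 < b. Proof. exact: (row_energy_gt0 r_gt0 Xs_svd Xs_incoherent n_gt0). Qed.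
Let e0 : 0 < e. Proof. by rewrite /e !mulr_gt0 ?tolerance_gt0. Qed.
Let T0 : 0 < T.
Proof. by rewrite /T divr_gt0 ?exprn_gt0 // mulr_gt0 ?exprn_gt0 // mulr_gt0. Qed.

Let rate_ge k : (0 < k)%N -> (k = m \/ k = n) ->
  mu ^+ 2 * r%:R ^+ 2 * kap ^+ 4 * L / k%:R <= rate.
Proof.
move=> k0 hk; have k0' : 0 < k%:R :> R by rewrite ltr0n.
rewrite /rate.
have c0 : 0 <= mu ^+ 2 * r%:R ^+ 2 * kap ^+ 4 * L.
  by do 3!(rewrite mulr_ge0 ?exprn_ge0 ?ler0n ?(ltW mu0) ?(ltW kap0) ?(ltW L0) //).
set c := mu ^+ 2 * r%:R ^+ 2 * kap ^+ 4 * L in c0 *.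
have -> : mu ^+ 2 * r%:R ^+ 2 * kap ^+ 4 * N * L / (m%:R * n%:R) =
    c / k%:R * (k%:R * N / (m%:R * n%:R)).
  by rewrite /c; field; rewrite !gt_eqF.
rewrite ler_peMr ?divr_ge0 ?(ltW k0') //.
rewrite ler_pdivlMr ?mulr_gt0 // mul1r N_eq.
case: hk => ->; nra.
Qed.

(** The requirements of the Chernoff bound and of the form bound, for rows (k = n) and columns (k =
    m). The first follows from mu kap >= 1 and kap >= 1; in the second, both summands equal s1^2
    mu^2 r^2 / k, so the constant is 8 * 6 * 2 = 96. *)
Let form_bound k : (0 < k)%N -> (k = m \/ k = n) ->
  let bk := row_energy mu s k in let dl := s1 ^+ 2 * mu ^+ 2 / k%:R in
  2 * bk ^+ 2 * (6 * L) <= p * dl /\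
  8 * p * (6 * L) * (bk * (s1 * mu * r%:R) + r%:R ^+ 2 * dl) <= e ^+ 2.
Proof.
move=> k0 hk bk dl; have k0' : 0 < k%:R :> R by rewrite ltr0n.
have hr := rate_ge k0 hk; have he := e1_gt0.
split.
  have -> : 2 * bk ^+ 2 * (6 * L) = dl * (12 * (r%:R ^+ 2 * L / k%:R)).
    by rewrite /bk /dl /row_energy -/s1; field; rewrite gt_eqF.
  rewrite [p * _]mulrC ler_wpM2l //.
    by rewrite divr_ge0 ?(ltW k0') // mulr_ge0 ?exprn_ge0 // ltW.
  apply: le_trans (p_rate1 (_ : 0 <= 12) _); [|lra|lra].
  rewrite ler_wpM2l //; apply: le_trans hr.
  have -> : mu ^+ 2 * r%:R ^+ 2 * kap ^+ 4 * L / k%:R =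
      (mu * kap) ^+ 2 * kap ^+ 2 * (r%:R ^+ 2 * L / k%:R).
    by field; rewrite gt_eqF.
  rewrite ler_peMl //.
    by rewrite divr_ge0 ?(ltW k0') // mulr_ge0 ?exprn_ge0 // ltW.
  by rewrite -exprMn exprn_ege1 // mulr_ege1.
have -> : 8 * p * (6 * L) * (bk * (s1 * mu * r%:R) + r%:R ^+ 2 * dl) =
    p * sr ^+ 2 * (96 * (mu ^+ 2 * r%:R ^+ 2 * kap ^+ 2 * L / k%:R)).
  by rewrite /bk /dl /row_energy -/s1 s1E; field; rewrite gt_eqF.
have -> : e ^+ 2 = p * sr ^+ 2 * (tolerance ^+ 2 * p) by rewrite /e; ring.
rewrite ler_wpM2l ?mulr_ge0 ?sqr_ge0 ?(ltW p0) ?(ltW sr0) //.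
apply: le_trans (p_rate (_ : 0 <= 96) _); [|lra|lra].
rewrite ler_wpM2l //; apply: le_trans hr.
rewrite ler_wpM2r ?invr_ge0 ?(ltW k0') // ler_wpM2r ?(ltW L0) //.
rewrite ler_wpM2l ?mulr_ge0 ?exprn_ge0 ?(ltW mu0) //.
by rewrite ler_weXn2l.
Qed.

(** The first bound is the hypothesis of the trace estimate. The second makes the l-th moment,
    divided by T^l, at most m exp(-l). *)
Let trace_rate l : 4 * L <= l%:R <= 8 * L ->
  (2 * l)%:R <= p * N /\ 8 * l%:R * (p * N) / T <= expR (- 1).
Proof.
move=> /andP[l1 l2]; have he := e1_gt0; have hL := L0; split.
  rewrite natrM; apply: (@le_trans _ _ (16 * L)); first lra.
  have h := p_rate1 (_ : 0 <= 16) _; have {}h : 16 * rate <= p by apply: h; lra.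
  rewrite -ler_pdivrMr //; apply: le_trans h.
  rewrite -mulrA ler_wpM2l // ler_pdivrMr //.
  have -> : rate * N = L * (((mu * kap) * (r%:R * kap)) ^+ 2 * (N ^+ 2 / (m%:R * n%:R))).
    by rewrite /rate; field; rewrite !gt_eqF.
  rewrite ler_peMr ?(ltW L0) // mulr_ege1 //.
    by rewrite exprn_ege1 // mulr_ege1 // mulr_ege1.
  rewrite ler_pdivlMr ?mulr_gt0 // mul1r N_eq; nra.
rewrite ler_pdivrMr // expRN.
have -> : T = p * N * L * (tolerance ^+ 2 * p) / rate.
  rewrite /T /e /a /b /row_energy -/s1 s1E /rate; field.
  have rp : 0 < r%:R :> R by rewrite ltr0n.
  by rewrite !gt_eqF ?addr_gt0.
rewrite ler_pdivlMl //.
have h : 64 * expR 1 * rate <= tolerance ^+ 2 * p by apply: p_rate; lra.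
have pN : 0 <= p * N by rewrite mulr_ge0 // ltW.
rewrite ler_pdivlMr //.
have h2 := ler_wpM2l (mulr_ge0 pN (ltW L0)) h.
apply: le_trans h2.
have -> : expR 1 * (8 * l%:R * (p * N)) * rate = (p * N * (expR 1 * rate)) * (8 * l%:R) by ring.
have -> : p * N * L * (64 * expR 1 * rate) = (p * N * (expR 1 * rate)) * (64 * L) by ring.
apply: ler_wpM2l; last by lra.
by rewrite mulr_ge0 // mulr_ge0 ?expR_ge0 // ltW.
Qed.

(** Markov's inequality for the sum of three nonnegative tests: a total below 1 forces the operator,
    row and column bounds together, and its expectation is at most 3 N^(-3). *)
Lemma recovery_probability :
  1 - 3 * N ^- 3 <= sampling_prob p (fun Om =>
    forall (A : 'M[R]_(m, r)) (B : 'M[R]_(n, r)),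
      second_order_stationary (factored_loss p Om Xs) (A, B) ->
      local_region c2 mu Xs s (A *m B^T) -> A *m B^T = Xs).
Proof.
(* Order at least 4 log N makes m exp(-l) at most N N^(-4). *)
have [alpha] : exists alpha : nat, 4 * L <= (2 ^ alpha)%:R <= 2 * (4 * L).
  by apply: exists_pow2_between; have := L_ge; lra.
set l := (2 ^ alpha)%N => /andP[l1 l2].
have [hl1 hl2] : (2 * l)%:R <= p * N /\ 8 * l%:R * (p * N) / T <= expR (- 1).
  by apply: trace_rate; apply/andP; split; lra.
have p01 : 0 <= p <= 1 by rewrite (ltW p0).
have p01' : 0 < p <= 1 by rewrite p0.
pose dl k : R := s1 ^+ 2 * mu ^+ 2 / k%:R.
have dl0 k : (0 < k)%N -> 0 < dl k.
  by move=> k0; rewrite divr_gt0 ?ltr0n // mulr_gt0 ?exprn_gt0.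
pose row_test (Om : {set 'I_m * 'I_n}) := \sum_i form_witness p (fun j => (i, j)) Bs (dl n) (6 * L) Om.
pose col_test (Om : {set 'I_m * 'I_n}) := \sum_j form_witness p (fun i => (i, j)) As (dl m) (6 * L) Om.
pose trace_test (Om : {set 'I_m * 'I_n}) := T ^- l * \tr ((centered_mx p Om *m (centered_mx p Om)^T) ^+ l).
pose f (Om : {set 'I_m * 'I_n}) := trace_test Om + (row_test Om + col_test Om).
have row_test0 Om i : 0 <= form_witness p (fun j => (i, j)) Bs (dl n) (6 * L) Om.
  exact: form_witness_ge0.
have col_test0 Om j : 0 <= form_witness p (fun i => (i, j)) As (dl m) (6 * L) Om.
  exact: form_witness_ge0.
have rowt0 Om : 0 <= row_test Om by apply: sumr_ge0 => ? _.
have colt0 Om : 0 <= col_test Om by apply: sumr_ge0 => ? _.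
have trt0 Om : 0 <= trace_test Om.
  by rewrite mulr_ge0 ?trace_gram_pow2_ge0 // invr_ge0 exprn_ge0 // ltW.
have [An1 An2] := form_bound n_gt0 (or_intror erefl).
have [Am1 Am2] := form_bound m_gt0 (or_introl erefl).
have L60 : 0 < 6 * L by rewrite mulr_gt0.
have pairl i : injective (fun j : 'I_n => (i, j) : 'I_m * 'I_n) by move=> ? ? [].
have pairr j : injective (fun i : 'I_m => (i, j) : 'I_m * 'I_n) by move=> ? ? [].
have Bs_row := Bs_row_le n_gt0 r_gt0 Xs_svd Xs_incoherent.
have As_row := As_row_le m_gt0 r_gt0 Xs_svd Xs_incoherent.
have mono k (Q : 'M[R]_(k, r)) : 0 < row_energy mu s k -> sqn Q <= s1 * mu * r%:R ->
    8 * p * (6 * L) * (row_energy mu s k * (s1 * mu * r%:R) + r%:R ^+ 2 * dl k) <= e ^+ 2 ->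
    8 * p * (6 * L) * (row_energy mu s k * sqn Q + r%:R ^+ 2 * dl k) <= e ^+ 2.
  move=> k0 hQ; apply: le_trans; rewrite ler_wpM2l ?mulr_ge0 ?(ltW p0) ?(ltW L0) //.
  by rewrite lerD2r ler_wpM2l // ltW.
apply: le_trans (sum_weight_ge p01 (f := f) _ _); last 2 first.
- by move=> Om; rewrite /f !addr_ge0.
- move=> Om fOm A B.
  have r0 := rowt0 Om; have c0 := colt0 Om; have t0 := trt0 Om.
  rewrite /f in fOm.
  apply: (@good_sample_recovers _ _ _ _ c2 mu Xs U s V m_gt0 n_gt0 r_gt0 Xs_svd
    Xs_incoherent p e T Om) => //.
  + exact: ltW.
  + exact: ltW.
  + apply: (sqn_mul_le_of_trace (a := alpha)); first exact: ltW.
    have : trace_test Om < 1 by lra.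
    by rewrite /trace_test mulrC ltr_pdivrMr ?exprn_gt0 // mul1r => /ltW.
  + move=> i; apply: (quadratic_form_ge (phi := fun j => (i, j)) Bs_row p0 (dl0 n n_gt0) L60 (ltW e0)).
      by apply: mono => //; exact: (sqn_Bs_le n_gt0 r_gt0 Xs_svd Xs_incoherent).
    apply: le_lt_trans (_ : row_test Om < 1); last lra.
    by rewrite /row_test (bigD1 i) //= lerDl; apply: sumr_ge0.
  + move=> j; apply: (quadratic_form_ge (phi := fun i => (i, j)) As_row p0 (dl0 m m_gt0) L60 (ltW e0)).
      by apply: mono => //; exact: (sqn_As_le m_gt0 r_gt0 Xs_svd Xs_incoherent).
    apply: le_lt_trans (_ : col_test Om < 1); last lra.
    by rewrite /col_test (bigD1 j) //= lerDl; apply: sumr_ge0.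
  + by rewrite -mulrA divfK // gt_eqF // mulr_gt0 ?exprn_gt0 // mulr_gt0.
  + rewrite /e; have -> : tolerance * p * sr * (2 + 2 * K) = p * sr * (tolerance * (2 + 2 * K)).
      by ring.
    by rewrite toleranceK mulrA mulr1.
rewrite lerB // /f !expectationD.
have N1 : 0 < N ^- 3 by rewrite invr_gt0 exprn_gt0.
have trE : expectation p trace_test <= N ^- 3.
  rewrite expectationZ.
  apply: (@le_trans _ _ (T ^- l * (m%:R * (8 * l%:R * (p * N)) ^+ l))).
    rewrite ler_wpM2l ?invr_ge0 ?exprn_ge0 ?(ltW T0) //.
    by apply: expectation_trace_le => //; rewrite expn_gt0.
  rewrite mulrCA -exprVn -exprMn [T^-1 * _]mulrC.
  apply: (@le_trans _ _ (m%:R * expR (- 1) ^+ l)).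
    rewrite ler_wpM2l // ler_pXn2r ?nnegrE ?expR_ge0 ?expn_gt0 //.
    by rewrite !mulr_ge0 ?invr_ge0 // ltW.
  rewrite -expRM_natl mulrN1.
  apply: (@le_trans _ _ (N * expR (- (4%:R * L)))).
    by apply: ler_pM; rewrite ?expR_ge0 ?ler_expR ?lerN2 // N_eq lerDl ltW.
  rewrite expR_opp_natl_ln // le_eqVlt; apply/orP; left; apply/eqP; field.
  by rewrite -N_eq gt_eqF.
have rN : r%:R <= N.
  by rewrite ler_nat (leq_trans r_le) // (leq_trans (geq_minl _ _)) // leq_addr.
(* There are (m + n) r^2 <= N^3 form entries, each with expected witness at most 2 N^(-6); this is
   why the forms use level 6L. *)
have formE : expectation p row_test + expectation p col_test <= 2 * N ^- 3.
  have hexp : expR (- (6 * L)) = N ^- 6 by exact: (expR_opp_natl_ln 6 N0).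
  apply: (@le_trans _ _ ((m%:R + n%:R) * (r%:R ^+ 2 * (2 * N ^- 6)))).
    rewrite mulrDl; apply: lerD.
      rewrite expectation_sum.
      apply: (@le_trans _ _ (\sum_(i < m) r%:R ^+ 2 * (2 * N ^- 6))); last first.
        by rewrite sumr_const card_ord -[leLHS]mulr_natl.
      apply: ler_sum => i _; rewrite -hexp.
      apply: (expectation_form_witness (pairl i) Bs_row) => //; rewrite ?(ltW L60) ?(ltW b0) //.
      exact: dl0.
    rewrite expectation_sum.
    apply: (@le_trans _ _ (\sum_(i < n) r%:R ^+ 2 * (2 * N ^- 6))); last first.
      by rewrite sumr_const card_ord -[leLHS]mulr_natl.
    apply: ler_sum => j _; rewrite -hexp.
    apply: (expectation_form_witness (pairr j) As_row) => //; rewrite ?(ltW L60) ?(ltW a0) //.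
    exact: dl0.
  rewrite -N_eq.
  have -> : 2 * N ^- 3 = N * (N ^+ 2 * (2 * N ^- 6)) by field; rewrite -N_eq gt_eqF.
  rewrite ler_wpM2l ?(ltW N0) // ler_wpM2r ?mulr_ge0 ?invr_ge0 ?exprn_ge0 ?(ltW N0) //.
  by rewrite ler_pXn2r ?nnegrE ?(ltW N0).
lra.
Qed.

End SampleComplexity.

Unset Implicit Arguments.

Theorem lemma9 (R : realType) (c2 : R) (hc2 : 0 < c2) :
  exists c1 C : R, 0 < c1 /\
    forall (m n r : nat) (mu p : R) (Xs : 'M[R]_(m, n))
      (U : 'M[R]_(m, r)) (s : 'rV[R]_r) (V : 'M[R]_(n, r)),
      (0 < m)%N -> (0 < n)%N -> (0 < r)%N -> (r <= minn m n)%N ->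
      \rank Xs = r ->
      compact_svd Xs U s V ->
      incoherent mu U s V ->
      0 <= p <= 1 ->
      c1 * (mu ^+ 2 * r%:R ^+ 2 * kappa s ^+ 4 * (m + n)%N%:R
              * ln (m + n)%N%:R / (m%:R * n%:R)) <= p ->
      1 - C * (minn m n)%:R ^- 3 <
        sampling_prob p (fun Om : {set 'I_m * 'I_n} =>
          forall (A : 'M[R]_(m, r)) (B : 'M[R]_(n, r)),
            second_order_stationary (factored_loss p Om Xs) (A, B) ->
            local_region c2 mu Xs s (A *m B^T) ->
            A *m B^T = Xs).
Proof.
(* The failure bound has constant 3; taking 4 makes the inequality strict. *)
exists (oversampling c2), 4; split; first exact: oversampling_gt0.
move=> m n r mu p Xs U s V m0 n0 r0 rmn _ svd inc /andP[_ p1] hp.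
apply: lt_le_trans (recovery_probability m0 n0 r0 rmn svd inc p1 hp).
have mn0 : 0 < (minn m n)%:R :> R by rewrite ltr0n leq_min m0 n0.
have mnN : (minn m n)%:R <= (m + n)%:R :> R.
  by rewrite ler_nat (leq_trans (geq_minl _ _)) // leq_addr.
have h : (m + n)%:R ^- 3 <= (minn m n)%:R ^- 3 :> R.
  by rewrite lef_pV2 ?posrE ?exprn_gt0 ?(lt_le_trans mn0) // ler_pXn2r ?nnegrE // ltW.
have h0 : 0 < (minn m n)%:R ^- 3 :> R by rewrite invr_gt0 exprn_gt0.
lra.
Qed.
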